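(* Let $f:\mathbb{R}^n\to\mathbb{R}$ be differentiable and (possibly non-convex) $L$-smooth with $L>0$, i.e. $\|\nabla f(x)-\nabla f(y)\|_2\le L\|x-y\|_2$ for all $x,y\in\mathbb{R}^n$, and suppose $f(x)\ge f_*$ for all $x\in\mathbb{R}^n$, where $f_*\in\mathbb{R}$. Let $\varepsilon>0$ and $x^0\in\mathbb{R}^n$. Consider the iterates $x^{k+1}=x^k-\frac{1}{2L}g^k$, $k=0,1,2,\ldots$, where $g^k=g(x^k)$ is a random gradient estimator, computed with fresh randomness at each iteration, such that for every $x\in\mathbb{R}^n$ $$\mathbb{E}[g(x)\mid x]=\nabla f(x),\qquad \mathbb{E}\big[\|g(x)-\nabla f(x)\|_2^2\mid x\big]\le\frac{\varepsilon^2}{2}.$$ For an integer $N\ge1$, let $\hat x^N$ be chosen uniformly at random from $x^0,x^1,\ldots,x^{N-1}$, independently of everything else. (1) For every integer $N\ge 1$, $$\mathbb{E}\big[\|\nabla f(\hat x^N)\|_2^2\big]\le\frac{4L(f(x^0)-f_* )}{N}+\frac{\varepsilon^2}{2}.$$ In particular, if $N=\frac{8L(f(x^0)-f_* )}{\varepsilon^2}$ then $\mathbb{E}[\|\nabla f(\hat x^N)\|_2^2]\le\varepsilon^2$. (2) Suppose moreover that $f(x)=\mathbb{E}_\xi[f(x,\xi)]$, where $\xi$ has distribution $\mathcal{D}$, and that for all $x\in\mathbb{R}^n$ $$\mathbb{E}_\xi[\nabla f(x,\xi)]=\nabla f(x),\qquad \mathbb{E}_\xi\big[\|\nabla f(x,\xi)-\nabla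 f(x)\|_2^2\big]\le\sigma^2 .$$ Then the mini-batch estimator $g(x)=\frac1r\sum_{i=1}^r\nabla f(x,\xi_i)$ with $\xi_1,\ldots,\xi_r$ i.i.d. from $\mathcal{D}$ (drawn afresh at each iteration) and $r=\max\{1,\frac{2\sigma^2}{\varepsilon^2}\}$ satisfies the two conditions on $g$ above. With this estimator and $N=\frac{8L(f(x^0)-f_* )}{\varepsilon^2}$, one has $\mathbb{E}[\|\nabla f(\hat x^N)\|_2^2]\le\varepsilon^2$, and the total number of evaluations of stochastic gradients $\nabla f(x,\xi)$ is $$\max\left\{\frac{8L(f(x^0)-f_* )}{\varepsilon^2},\ \frac{16L(f(x^0)-f_* )\sigma^2}{\varepsilon^4}\right\}.$$
   Context: $\|\cdot\|_2$ is the Euclidean norm on $\mathbb{R}^n$. $\nabla f(x,\xi)$ denotes the gradient in $x$ of $f(\cdot,\xi)$. Conditioning on $x$ means that, at iteration $k$, the estimator $g(x^k)$ satisfies the stated identities conditionally on the current iterate $x^k$. The values $r$ and $N$ given by formulas are understood to be positive integers (rounding is ignored). *)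

(* Defs.v *)
From HB Require Import structures.
From mathcomp Require Import all_boot all_order all_algebra.
From mathcomp Require Import all_classical all_reals all_analysis.

Set Implicit Arguments.
Unset Strict Implicit.
Unset Printing Implicit Defensive.
Import Order.TTheory GRing.Theory Num.Theory.
Import numFieldNormedType.Exports.
Local Open Scope classical_set_scope.
Local Open Scope ring_scope.

(* The library norm `|x| on 'rV[R]_n is the sup norm. It has the same topology
   as the Euclidean norm, hence the same notion of differentiability, but
   metric statements must use [enorm]. *)
Definition enorm (R : realType) (n : nat) (x : 'rV[R]_n) : R :=
  Num.sqrt (\sum_(i < n) x ord0 i ^+ 2).

Definition grad (R : realType) (n : nat) (f : 'rV[R]_n -> R) (x : 'rV[R]_n) :
  'rV[R]_n := \row_(i < n) 'D_(delta_mx ord0 i) f x.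

Definition L_smooth (R : realType) (n : nat) (L : R) (f : 'rV[R]_n -> R) : Prop :=
  (forall x, differentiable f x) /\
  (forall x y, enorm (grad f x - grad f y) <= L * enorm (x - y)).

(* R^n with its Borel sigma-algebra. *)
Notation borelRn R n := (g_sigma_algebraType (@open 'rV[R]_n)).

Section probability_notions.
Context (R : realType) (d : measure_display) (T : measurableType d)
  (P : probability T R).

Definition is_cond_exp (F : set (set T)) (Z Y : T -> R) : Prop :=
  [/\ P.-integrable setT (EFin \o Z),
      P.-integrable setT (EFin \o Y),
      (forall B : set R, measurable B -> F (Y @^-1` B)) &
      forall A, F A -> (\int[P]_(w in A) (Z w)%:E = \int[P]_(w in A) (Y w)%:E)%E].

(* Events generated by a family of random elements. *)
Definition sigma_family (I : Type) (d' : measure_display) (S : measurableType d')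
    (X : I -> T -> S) : set (set T) :=
  <<s \bigcup_i g_sigma_algebra_preimage (X i) >>.

Definition independent_systems (F G : set (set T)) : Prop :=
  forall A B, F A -> G B -> P (A `&` B) = (P A * P B)%E.

Definition mutually_independent (I : eqType) (d' : measure_display)
    (S : measurableType d') (X : I -> T -> S) : Prop :=
  forall (s : seq I) (A : I -> set S), uniq s -> (forall i, measurable (A i)) ->
    P (\bigcap_(i in [set` s]) (X i @^-1` A i)) =
    (\prod_(i <- s) P (X i @^-1` A i))%E.

Definition iid (I : eqType) (d' : measure_display) (S : measurableType d')
    (D : probability S R) (X : I -> T -> S) : Prop :=
  [/\ (forall i, measurable_fun setT (X i)),
      (forall i A, measurable A -> P (X i @^-1` A) = D A) &
      mutually_independent X].

(* J is uniform on {0, ..., N-1} and independent of the events in F. *)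
Definition uniform_index (N : nat) (J : T -> nat) (F : set (set T)) : Prop :=
  [/\ measurable_fun setT J,
      (forall k, (k < N)%N -> P (J @^-1` [set k]) = (N%:R^-1)%:E) &
      independent_systems (g_sigma_algebra_preimage J) F].

Definition has_mean (n : nat) (Z : T -> 'rV[R]_n) (m : 'rV[R]_n) : Prop :=
  forall i, P.-integrable setT (fun w => (Z w ord0 i)%:E) /\
            ('E_P[fun w => Z w ord0 i] = (m ord0 i)%:E)%E.

(* For each fixed point x, the random vector w |-> G x w has mean grad f x and
   mean squared deviation at most v. *)
Definition gradient_estimator (n : nat) (f : 'rV[R]_n -> R) (v : R)
    (G : 'rV[R]_n -> T -> 'rV[R]_n) : Prop :=
  forall x, has_mean (G x) (grad f x) /\
            ('E_P[fun w => (enorm (G x w - grad f x) ^+ 2)%R] <= v%:E)%E.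

(* E[g | x] = grad f (x) and E[||g - grad f (x)||^2 | x] <= v almost surely,
   where x and g are random vectors. *)
Definition gradient_estimator_given (n : nat) (f : 'rV[R]_n -> R) (v : R)
    (x g : T -> 'rV[R]_n) : Prop :=
  let sigma_x := g_sigma_algebra_preimage (x : T -> borelRn R n) in
  (forall i, is_cond_exp sigma_x
     (fun w => g w ord0 i) (fun w => grad f (x w) ord0 i)) /\
  (exists Y : T -> R,
     is_cond_exp sigma_x (fun w => enorm (g w - grad f (x w)) ^+ 2) Y /\
     {ae P, forall w, Y w <= v}).

Definition sgd_process (n : nat) (f : 'rV[R]_n -> R) (L v : R) (x0 : 'rV[R]_n)
    (x g : nat -> T -> 'rV[R]_n) : Prop :=
  [/\ (forall w, x 0%N w = x0),
      (forall k w, x k.+1 w = x k w - (1 / (2 * L)) *: g k w),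
      (forall k, measurable_fun setT (g k : T -> borelRn R n)) &
      forall k, gradient_estimator_given f v (x k) (g k)].

(* E ||grad f (x^J)||^2. *)
Definition mean_sq_grad (n : nat) (f : 'rV[R]_n -> R)
    (x : nat -> T -> 'rV[R]_n) (J : T -> nat) : \bar R :=
  ('E_P[fun w => (enorm (grad f (x (J w) w)) ^+ 2)%R])%E.

End probability_notions.

(* The iterates driven by the maps g 0, g 1, ... *)
Fixpoint sgd (R : realType) (n : nat) (L : R) (x0 : 'rV[R]_n)
    (g : nat -> 'rV[R]_n -> 'rV[R]_n) (k : nat) : 'rV[R]_n :=
  if k is k'.+1 then
    let x := sgd L x0 g k' in x - (1 / (2 * L)) *: g k' x
  else x0.

Definition minibatch (R : realType) (n : nat) (Xi : Type)
    (F : 'rV[R]_n -> Xi -> R) (r : nat) (z : 'I_r -> Xi) (x : 'rV[R]_n) :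
  'rV[R]_n := (1 / r%:R) *: \sum_(i < r) grad (F ^~ (z i)) x.

(* Mini-batch SGD that carries, next to the current iterate, the number of
   stochastic gradients grad (F ^~ z) x evaluated so far. *)
Definition counted_sum (R : realType) (n : nat) (Xi : Type)
    (F : 'rV[R]_n -> Xi -> R) (x : 'rV[R]_n) (s : seq Xi) : 'rV[R]_n * nat :=
  foldr (fun z a => (grad (F ^~ z) x + a.1, a.2.+1)) (0, 0%N) s.

Fixpoint counted_minibatch_sgd (R : realType) (n : nat) (Xi : Type)
    (F : 'rV[R]_n -> Xi -> R) (L : R) (x0 : 'rV[R]_n) (r : nat)
    (z : nat -> 'I_r -> Xi) (k : nat) : 'rV[R]_n * nat :=
  if k is k'.+1 then
    let: (x, c) := counted_minibatch_sgd F L x0 z k' in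
    let: (s, m) := counted_sum F x [seq z k' i | i <- enum 'I_r] in
    (x - (1 / (2 * L)) *: ((1 / r%:R) *: s), (c + m)%N)
  else (x0, 0%N).

(* Main.v *)
Require Import Defs.
From HB Require Import structures.
From mathcomp Require Import all_boot all_order all_algebra.
From mathcomp Require Import all_classical all_reals all_analysis.
From mathcomp Require Import measurable_realfun.
From mathcomp Require Import ring lra.

Set Implicit Arguments.
Unset Strict Implicit.
Unset Printing Implicit Defensive.
Import Order.TTheory GRing.Theory Num.Theory.
Import numFieldNormedType.Exports.
Local Open Scope classical_set_scope.
Local Open Scope ring_scope.

(** The proof follows the path of the iterates before taking any expectation.
    Write G_k for the gradient at x_k and e_k = g_k - G_k for the noise.  Since
    f is L-smooth, one step of length 1/(2L) gives ([sgd_step_descent])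

      3/(8L) |G_k|^2 <= f x_k - f x_(k+1) - 1/(4L) <G_k, e_k> + 1/(8L) |e_k|^2.

    Summing over k < N telescopes f for every single outcome, and f >= fstar
    bounds what is left ([sgd_path]); so f x_k itself is never integrated.  In
    the mean the cross terms vanish and each |e_k|^2 contributes at most v,
    which bounds the average of E |G_k|^2 by 8L (f x0 - fstar) / (3N) + v / 3
    ([sgd_mean_sq_grad]).

    Two facts of the same kind are used here: E <G_k, e_k> = 0, and sampling
    the index J uniformly replaces h (x_J) by the average of the h (x_k).  In
    both cases a variable e has integral 0 over every event of the
    sigma-algebra of X and must be shown orthogonal to every h (X)
    ([integral_comp_ortho]); e is a coordinate of the noise in the first case
    and the centred indicator of J = k in the second.  That all the products
    are integrable comes from the square-integrability of the iterates, which
    propagates because the gradient is Lipschitz ([sgd_L2vec]).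

    When the estimators are driven by independent seeds, the conditional
    hypotheses have to be produced.  The iterate x_k is measurable for the
    seeds of the earlier stages, and these are independent of the seeds of
    stage k ([grouping]); integrating out the latter with x_k frozen
    ([freezing]) turns the moment conditions at fixed points into conditional
    ones ([fresh_estimator]).  For the mini-batch estimator this needs joint
    measurability of the stochastic gradient, which only enters the hypotheses
    through separate regularity in x and in the sample: it is a limit of
    difference quotients of a function that is continuous in x and measurable
    in the sample ([grad_measurable]).  Its variance is divided by the batch
    size because distinct samples are uncorrelated ([average_variance]). *)

(** * Euclidean geometry and the descent inequality *)

Definition dot (R : realType) (n : nat) (x y : 'rV[R]_n) : R :=
  \sum_(i < n) x ord0 i * y ord0 i.

Section euclidean.
Context (R : realType) (n : nat).
Implicit Types x y z : 'rV[R]_n.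

Lemma dotDl x y z : dot (x + y) z = dot x z + dot y z.
Proof.
by rewrite /dot -big_split; apply: eq_bigr => i _; rewrite !mxE mulrDl.
Qed.

Lemma dotC x y : dot x y = dot y x.
Proof. by apply: eq_bigr => i _; rewrite mulrC. Qed.

Lemma dotZl (c : R) x y : dot (c *: x) y = c * dot x y.
Proof. by rewrite /dot mulr_sumr; apply: eq_bigr => i _; rewrite mxE mulrA. Qed.

Lemma dotDr x y z : dot x (y + z) = dot x y + dot x z.
Proof. by rewrite dotC dotDl !(dotC x). Qed.

Lemma dotZr (c : R) x y : dot x (c *: y) = c * dot x y.
Proof. by rewrite dotC dotZl (dotC x). Qed.

Lemma enorm_ge0 x : 0 <= enorm x.
Proof. exact: sqrtr_ge0. Qed.

Lemma enorm_sqr x : enorm x ^+ 2 = dot x x.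
Proof. by rewrite sqr_sqrtr// sumr_ge0// => i _; rewrite sqr_ge0. Qed.

Lemma coord_sqr_le x i : x ord0 i ^+ 2 <= enorm x ^+ 2.
Proof.
rewrite enorm_sqr /dot (bigD1 i)//= -expr2 lerDl.
by rewrite sumr_ge0// => j _; rewrite -expr2 sqr_ge0.
Qed.

Lemma coord_le_enorm x i : `|x ord0 i| <= enorm x.
Proof.
rewrite -(ler_pXn2r (n := 2)) ?nnegrE ?enorm_ge0 ?normr_ge0//.
by rewrite real_normK ?num_real// coord_sqr_le.
Qed.

Lemma enorm_le_norm x : enorm x <= n.+1%:R * `|x|.
Proof.
rewrite -(ler_pXn2r (n := 2)) ?nnegrE ?enorm_ge0 ?mulr_ge0//.
rewrite enorm_sqr /dot; apply: (@le_trans _ _ (\sum_(i < n) `|x| ^+ 2)).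
  apply: ler_sum => i _; rewrite -expr2 -real_normK ?num_real//.
  rewrite ler_pXn2r ?nnegrE//.
  rewrite [leRHS]/Num.norm /= mx_normrE.
  by apply/bigmax_geP; right => /=; exists (ord0, i).
rewrite sumr_const card_ord -[leLHS]mulr_natl exprMn ler_wpM2r ?sqr_ge0//.
by rewrite -natrX ler_nat (leq_trans (leqnSn n))// expnS expn1 leq_pmulr.
Qed.

(** Young's inequality with a weight. It replaces the Cauchy-Schwarz
    inequality, because the weight can be chosen along the segment in
    [descent_lemma]. *)
Lemma dot_le x y (c : R) : 0 < c ->
  dot x y <= (2 * c)^-1 * enorm x ^+ 2 + c / 2 * enorm y ^+ 2.
Proof.
move=> c0; rewrite !enorm_sqr /dot !mulr_sumr -big_split.
apply: ler_sum => i _ /=; set a := x _ _; set b := y _ _.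
rewrite -subr_ge0.
have -> : (2 * c)^-1 * (a * a) + c / 2 * (b * b) - a * b
  = (2 * c)^-1 * (a - c * b) ^+ 2 by field; rewrite gt_eqF.
by rewrite mulr_ge0 ?sqr_ge0// invr_ge0; lra.
Qed.

Lemma diff_dot (f : 'rV[R]_n -> R) x y :
  differentiable f x -> 'd f x y = dot (grad f x) y.
Proof.
move=> df; rewrite [in LHS](row_sum_delta y) linear_sum.
apply: eq_bigr => i _.
have -> : 'd f x (y ord0 i *: delta_mx ord0 i) =
    y ord0 i * 'd f x (delta_mx ord0 i) by exact: (linearZ_LR ('d f x)).
by rewrite mxE deriveE// mulrC.
Qed.

(** The difference quotients of f along the line are literally those of the
    directional derivative, so no chain rule is involved. *)
Lemma is_derive_line (f : 'rV[R]_n -> R) x y (t : R) :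
  differentiable f (t *: y + x) ->
  is_derive t 1 (fun s => f (s *: y + x)) (dot (grad f (t *: y + x)) y).
Proof.
move=> df; have E : (fun h : R => h^-1 *:
    (((fun s => f (s *: y + x)) \o shift t) (h *: 1) - f (t *: y + x))) =
  (fun h => h^-1 *: ((f \o shift (t *: y + x)) (h *: y) - f (t *: y + x))).
  by apply/funext => h /=; rewrite [_%:A]mulr1 scalerDl addrA.
apply: DeriveDef; first by rewrite /derivable E; exact: diff_derivable.
rewrite {1}/derive E -/(derive _ _ _) deriveE//.
exact: diff_dot.
Qed.

End euclidean.

Section descent.
Context (R : realType) (n : nat) (L : R) (f : 'rV[R]_n -> R).
Hypotheses (L_gt0 : 0 < L) (f_smooth : L_smooth L f).

Lemma grad_coord_continuous i : continuous (fun x => grad f x ord0 i).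
Proof.
move=> x; apply/(@cvgrPdist_le _ _ _ (nbhs x)) => e e0.
have c0 : 0 < L * n.+1%:R by rewrite mulr_gt0.
apply/nbhs_ballP; exists (e / (L * n.+1%:R)); first exact: divr_gt0.
move=> y; rewrite -ball_normE /= => xy.
have -> : grad f x ord0 i - grad f y ord0 i = (grad f x - grad f y) ord0 i.
  by rewrite !mxE.
apply: (le_trans (coord_le_enorm _ _)); apply: (le_trans (f_smooth.2 _ _)).
apply: (@le_trans _ _ (L * (n.+1%:R * `|x - y|))).
  by rewrite ler_pM2l// enorm_le_norm.
by rewrite mulrA -ler_pdivlMl// mulrC ltW.
Qed.

(** psi is f along the segment minus the quadratic upper bound; its derivative
    is <grad f (x + t v) - grad f x, v> - L t |v|^2, which the Lipschitz bound
    and [dot_le] with weight L t make nonpositive on [0, 1]. The inequality is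
    psi 1 <= psi 0. *)
Lemma descent_lemma (x v : 'rV[R]_n) :
  f (x + v) <= f x + dot (grad f x) v + L / 2 * enorm v ^+ 2.
Proof.
pose psi := fun t : R =>
  f (t *: v + x) - t * dot (grad f x) v - L / 2 * enorm v ^+ 2 * t ^+ 2.
have dpsi (t : R) : is_derive t 1 psi (dot (grad f (t *: v + x)) v
    - dot (grad f x) v - L * enorm v ^+ 2 * t).
  have H := is_derive_line (f_smooth.1 (t *: v + x)).
  have H2 : is_derive t 1 (fun s : R => s * dot (grad f x) v)
    (dot (grad f x) v).
    by apply: is_derive_eq; rewrite scaler0 add0r [_%:A]mulr1.
  have H3 : is_derive t 1 (fun s : R => L / 2 * enorm v ^+ 2 * s ^+ 2)
     (L * enorm v ^+ 2 * t).
    apply: is_derive_eq.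
    rewrite [LHS](_ : _ = L / 2 * enorm v ^+ 2 * (t * 1 + t * 1))//.
    set B := enorm v ^+ 2; clearbody B; by field.
  exact: (@is_deriveB _ _ _ _ _ _ _ _ _ (@is_deriveB _ _ _ _ _ _ _ _ _ H H2) H3).
have psi10 : psi 1 <= psi 0.
  apply: (@ler0_derive1_le_cc _ psi 0 1); rewrite ?in_itv/= ?lexx ?ler01//.
  - move=> t; rewrite in_itv/= => /andP[t0 t1].
    rewrite derive1E (@derive_val _ _ _ _ _ _ _ (dpsi t)).
    have -> : dot (grad f (t *: v + x)) v - dot (grad f x) v =
              dot (grad f (t *: v + x) - grad f x) v.
      by rewrite dotDl -[- grad f x]scaleN1r dotZl mulN1r.
    have Lt : 0 < L * t by rewrite mulr_gt0.
    have H : enorm (grad f (t *: v + x) - grad f x) ^+ 2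
        <= (L * t) ^+ 2 * enorm v ^+ 2.
      rewrite -exprMn ler_pXn2r ?nnegrE ?enorm_ge0//; last first.
        by rewrite mulr_ge0 ?enorm_ge0// ltW.
      apply: le_trans (f_smooth.2 _ _) _; rewrite addrK -mulrA ler_pM2l//.
      rewrite -(ler_pXn2r (n := 2)) ?nnegrE ?enorm_ge0 ?mulr_ge0 ?enorm_ge0 ?(ltW t0)//.
      by rewrite exprMn !enorm_sqr dotZl dotC dotZl expr2 mulrA.
    have := dot_le (grad f (t *: v + x) - grad f x) v Lt.
    set D := dot _ _; set A := enorm (_ - _) ^+ 2 in H *; set B := enorm v ^+ 2 in H *.
    have H' : (2 * (L * t))^-1 * A <= (2 * (L * t))^-1 * ((L * t) ^+ 2 * B).
      by rewrite ler_pM2l// invr_gt0 mulr_gt0.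
    have E : (2 * (L * t))^-1 * ((L * t) ^+ 2 * B) = L * t / 2 * B.
      by field; rewrite !gt_eqF.
    rewrite E in H'; nra.
  - apply: continuous_subspaceT => t.
    by apply: differentiable_continuous; apply/derivable1_diffP; case: (dpsi t).
move: psi10; rewrite /psi scale1r scale0r add0r [v + x]addrC.
by rewrite mul1r mul0r expr1n expr0n/= mulr1 mulr0 !subr0; lra.
Qed.

Lemma sgd_step_descent (x g : 'rV[R]_n) :
  3 / (8 * L) * enorm (grad f x) ^+ 2 <=
  f x - f (x - (1 / (2 * L)) *: g)
  - 1 / (4 * L) * dot (grad f x) (g - grad f x)
  + 1 / (8 * L) * enorm (g - grad f x) ^+ 2.
Proof.
set c := 1 / (2 * L).
have cE : L / 2 * c ^+ 2 = c / 4 by rewrite /c; field; rewrite gt_eqF.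
have -> : 3 / (8 * L) = 3 / 4 * c by rewrite /c; field; rewrite gt_eqF.
have -> : 1 / (4 * L) = c / 2 by rewrite /c; field; rewrite gt_eqF.
have -> : 1 / (8 * L) = c / 4 by rewrite /c; field; rewrite gt_eqF.
have := descent_lemma x (- (c *: g)).
rewrite -scaleNr !enorm_sqr !(dotZl, dotZr).
set e := g - grad f x.
have -> : g = e + grad f x by rewrite subrK.
clearbody e; rewrite !(dotDl, dotDr) (dotC e (grad f x)).
set G := dot (grad f x) (grad f x); set M := dot (grad f x) e.
set E := dot e e; set a := f x; set b := f _.
have -> : L / 2 * (- c * (- c * (E + M + (M + G)))) =
  L / 2 * c ^+ 2 * (E + M + (M + G)) by ring.
by rewrite cE; lra.
Qed.

End descent.

(** * Borel measurability on row vectors *)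

Section borel.
Context (R : realType) (n : nat).

Lemma continuous_borelRn (g : 'rV[R]_n -> R) : continuous g ->
  measurable_fun setT (g : borelRn R n -> R).
Proof.
move=> /continuousP cg; apply: (measurability _ (RGenOpens.measurableE R)).
move=> _ [_ [a [b ->] <-]]; rewrite setTI.
by apply: sub_sigma_algebra; apply: cg; exact: interval_open.
Qed.

Lemma borelRn_coord i : measurable_fun setT
  ((fun x => x ord0 i) : borelRn R n -> R).
Proof. by apply: continuous_borelRn; exact: coord_continuous. Qed.

(** Index of the cube that contains x in the grid of mesh 1/(m+1). *)
Definition cell (m : nat) (x : 'rV[R]_n) : 'rV[int]_n :=
  \row_i Num.floor (x ord0 i * m.+1%:R).

Definition corner (m : nat) (a : 'rV[int]_n) : 'rV[R]_n :=
  \row_i ((a ord0 i)%:~R / m.+1%:R).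

Lemma cell_dist m (x y : 'rV[R]_n) i : cell m x = cell m y ->
  `|x ord0 i - y ord0 i| < m.+1%:R^-1.
Proof.
move=> /rowP/(_ i); rewrite !mxE => xy.
have /andP[a b] := floor_itv (x ord0 i * m.+1%:R).
have /andP[c d] := floor_itv (y ord0 i * m.+1%:R).
rewrite xy intrD in b, c a *; rewrite intrD in d.
have m0 : 0 < m.+1%:R :> R by [].
rewrite -[ltRHS]mul1r ltr_pdivlMr//.
have -> : `|x ord0 i - y ord0 i| * m.+1%:R =
    `|x ord0 i * m.+1%:R - y ord0 i * m.+1%:R|.
  by rewrite -mulrBl normrM (gtr0_norm m0).
by rewrite ltr_norml; apply/andP; split; lra.
Qed.

Lemma cell_corner m a : cell m (corner m a) = a.
Proof. by apply/rowP => i; rewrite !mxE divfK ?intrKfloor// pnatr_eq0. Qed.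

Lemma corner_cvg (x : 'rV[R]_n) : corner m (cell m x) @[m --> \oo] --> x.
Proof.
apply/cvg_ballP => e e0; near=> m; split => // i j.
rewrite (ord1 i) -ball_normE /=.
apply: lt_trans (cell_dist j (esym (cell_corner m (cell m x)))) _.
by near: m; exact: near_infty_natSinv_lt (PosNum e0).
Unshelve. all: by end_near. Qed.

Context d (T : measurableType d).

Lemma cell_measurable (X : T -> 'rV[R]_n) m a :
  (forall i, measurable_fun setT (fun w => X w ord0 i)) ->
  measurable [set w | cell m (X w) = a].
Proof.
move=> mX; have -> : [set w | cell m (X w) = a] = \bigcap_(i in [set: 'I_n])
    (fun w => X w ord0 i * m.+1%:R) @^-1`
      `[(a ord0 i)%:~R, (a ord0 i + 1)%:~R[%classic.
  apply/seteqP; split=> [w /= <- i _|w /= H].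
    by rewrite /= in_itv/= mxE floor_itv.
  apply/rowP => i; have := H i Logic.I; rewrite /= in_itv/= -floor_eq => /eqP.
  by rewrite mxE.
apply: fin_bigcap_measurable; first exact: finite_finset.
move=> i _; rewrite -[X in measurable X]setTI.
by apply: measurable_funM.
Qed.

(** An open set is the countable union of the grid cubes, over all meshes,
    that it contains; the preimage of a cube is a finite intersection of
    preimages of intervals. *)
Lemma measurable_borelRn (X : T -> 'rV[R]_n) :
  (forall i, measurable_fun setT (fun w => X w ord0 i)) ->
  measurable_fun setT (X : T -> borelRn R n).
Proof.
move=> mX; apply: (@measurability _ _ _ (borelRn R n) _ _ (@open 'rV[R]_n)) => //.
move=> _ [U oU <-]; rewrite setTI.
have -> : X @^-1` U = \bigcup_m \bigcup_(a : 'rV[int]_n)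
    (if `[< cell m @^-1` [set a] `<=` U >] then [set w | cell m (X w) = a]
     else set0).
  apply/seteqP; split=> [w /= Uw|w [m _ [a _]]]; last first.
    by case: ifPn => // /asboolP aU wa; apply: aU.
  have /nbhs_ballP[e e0 eU] : nbhs (X w) U by exact: open_nbhs_nbhs.
  have [m _ /(_ m (leqnn m)) /= me] := near_infty_natSinv_lt (PosNum e0).
  exists m => //; exists (cell m (X w)) => //; rewrite ifT//.
  apply/asboolP => y /= yX; apply: eU; split => // i j; rewrite (ord1 i).
  by rewrite -ball_normE /=; apply: lt_trans me; exact: cell_dist.
apply: bigcupT_measurable => m; apply: countable_bigcupT_measurable => //.
by move=> a; case: ifPn => _ //; exact: cell_measurable.
Qed.

Lemma measurable_coord (X : T -> borelRn R n) i :
  measurable_fun setT X -> measurable_fun setT (fun w => X w ord0 i).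
Proof. by move=> mX; apply: (measurableT_comp (borelRn_coord i) mX). Qed.

Lemma measurable_dot (X Y : T -> 'rV[R]_n) :
  (forall i, measurable_fun setT (fun w => X w ord0 i)) ->
  (forall i, measurable_fun setT (fun w => Y w ord0 i)) ->
  measurable_fun setT (fun w => dot (X w) (Y w)).
Proof.
by move=> mX mY; apply: measurable_sum => i; exact: measurable_funM.
Qed.

End borel.

Section caratheodory.
Context (R : realType) (n : nat) d (S : measurableType d).
Variable F : 'rV[R]_n -> S -> R.
Hypothesis mF : forall x, measurable_fun setT (F x).

(** Replacing x by the corner of its grid cube leaves countably many values of
    x, so that the function becomes a countable union of measurable pieces; by
    continuity these functions converge pointwise to F. *)
Lemma caratheodory_measurable : (forall z, continuous (F ^~ z)) ->
  measurable_fun setT (fun p : borelRn R n * S => F p.1 p.2).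
Proof.
move=> cF; apply: (@measurable_fun_cvg _ _ _ _
  (fun m (p : borelRn R n * S) => F (corner R m (cell m p.1)) p.2)).
  move=> m _ B mB; rewrite setTI.
  have -> : (fun p : borelRn R n * S => F (corner R m (cell m p.1)) p.2) @^-1` B =
      \bigcup_(a : 'rV[int]_n) ([set x : borelRn R n | cell m x = a] `*`
        (F (corner R m a) @^-1` B)).
    apply/seteqP; split=> [[x z] /= Bx|[x z] [a _ [/= -> ]]//].
    by exists (cell m x).
  apply: countable_bigcupT_measurable => // a; apply: measurableX.
    by apply: (@cell_measurable _ _ _ (borelRn R n) idfun) => i; exact: borelRn_coord.
  by rewrite -[X in measurable X]setTI; exact: mF.
move=> [x z] _; apply: (@cvg_comp _ _ _ (fun m => corner R m (cell m x)) (F ^~ z)).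
  exact: corner_cvg.
exact: cF.
Qed.

(** A partial derivative is the limit of the difference quotients with steps
    1/(m+1), each of which is jointly measurable. *)
Lemma grad_measurable i : (forall z x, differentiable (F ^~ z) x) ->
  measurable_fun setT
    (fun p : borelRn R n * S => grad (F ^~ p.2) p.1 ord0 i).
Proof.
move=> dF; have mF2 : measurable_fun setT (fun p : borelRn R n * S => F p.1 p.2).
  by apply: caratheodory_measurable => z x; apply: differentiable_continuous.
pose h m (p : borelRn R n * S) : R := (m.+1%:R^-1)^-1 *
  (F (m.+1%:R^-1 *: delta_mx ord0 i + p.1) p.2 - F p.1 p.2).
apply: (@measurable_fun_cvg _ _ _ _ h).
  move=> m; apply: measurable_funM => //; apply: measurable_funB => //.
  apply: (@measurableT_comp _ _ _ _ _ _
    (fun p : borelRn R n * S => F p.1 p.2) _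
    (fun p : borelRn R n * S =>
      ((m.+1%:R^-1 *: delta_mx ord0 i + p.1 : borelRn R n), p.2))) => //.
  apply: measurable_fun_pair => //; apply: measurable_borelRn => j.
  under eq_fun do rewrite mxE; apply: measurable_funD => //.
  exact: (measurableT_comp (borelRn_coord j)).
move=> [x z] _; rewrite mxE.
have H : derivable (F ^~ z) x (delta_mx ord0 i) by exact: diff_derivable.
apply: (@cvg_comp _ _ _ (fun m => m.+1%:R^-1) (fun h : R => h^-1 *:
  (((F ^~ z) \o shift x) (h *: delta_mx ord0 i) - F x z)) \oo (0 : R)^'); last first.
  exact: H.
move=> A [e /= e0 eA].
have [m _ mA] := near_infty_natSinv_lt (PosNum e0).
exists m => // k mk; apply: eA => /=; last by rewrite invr_eq0.
by rewrite sub0r normrN gtr0_norm// mA.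
Qed.

End caratheodory.

(** * Integrable functions and orthogonality *)

Section integrable_real.
Context d (T : measurableType d) (R : realType) (P : probability T R).
Implicit Types f g : T -> R.

Definition L1 f := P.-integrable setT (EFin \o f).

Lemma L1_measurable f : L1 f -> measurable_fun setT f.
Proof. by move=> /measurable_int/measurable_EFinP. Qed.

Lemma L1_le f g : measurable_fun setT f -> (forall w, `|f w| <= g w) ->
  L1 g -> L1 f.
Proof.
move=> mf fg; apply: le_integrable => //; first exact/measurable_EFinP.
by move=> w _ /=; rewrite lee_fin (le_trans (fg w))// ler_norm.
Qed.

Lemma L1_cst c : L1 (fun=> c).
Proof. exact: finite_measure_integrable_cst. Qed.

Lemma L1D f g : L1 f -> L1 g -> L1 (fun w => f w + g w).
Proof.
by move=> Lf Lg; apply: eq_integrable (integrableD measurableT Lf Lg).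
Qed.

Lemma L1Z c f : L1 f -> L1 (fun w => c * f w).
Proof. by move=> Lf; apply: eq_integrable (integrableZl measurableT c Lf). Qed.

Lemma L1B f g : L1 f -> L1 g -> L1 (fun w => f w - g w).
Proof.
by move=> Lf Lg; apply: eq_integrable (integrableB measurableT Lf Lg).
Qed.

Lemma L1_sum (I : Type) (s : seq I) (h : I -> T -> R) :
  (forall i, L1 (h i)) -> L1 (fun w => \sum_(i <- s) h i w).
Proof.
move=> Lh.
have := @integrable_sum _ _ _ P setT measurableT I s xpredT _ (fun i _ => Lh i).
apply: eq_integrable => //.
by move=> w _; rewrite /= sumEFin.
Qed.

Lemma integral_L1_sum (I : Type) (s : seq I) (h : I -> T -> R) :
  (forall i, L1 (h i)) ->
  (\int[P]_w (\sum_(i <- s) h i w)%:E = \sum_(i <- s) \int[P]_w (h i w)%:E)%E.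
Proof.
by move=> Lh; rewrite -integral_sum//; apply: eq_integral => w _; rewrite sumEFin.
Qed.

Lemma integral_L1Z c f : L1 f ->
  (\int[P]_w (c * f w)%:E = c%:E * \int[P]_w (f w)%:E)%E.
Proof. by move=> Lf; rewrite -integralZl. Qed.

Lemma integral_L1D f g : L1 f -> L1 g ->
  (\int[P]_w (f w + g w)%:E = \int[P]_w (f w)%:E + \int[P]_w (g w)%:E)%E.
Proof. by move=> Lf Lg; rewrite -integralD. Qed.

Lemma integral_L1B f g : L1 f -> L1 g ->
  (\int[P]_w (f w - g w)%:E = \int[P]_w (f w)%:E - \int[P]_w (g w)%:E)%E.
Proof. by move=> Lf Lg; rewrite -integralB. Qed.

Lemma ge0_L1 f c : measurable_fun setT f -> (forall w, 0 <= f w) ->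
  (\int[P]_w (f w)%:E <= c%:E)%E -> L1 f.
Proof.
move=> mf f0 fc; apply/integrableP; split; first exact/measurable_EFinP.
under eq_integral => w _ do rewrite /= ger0_norm//.
exact: le_lt_trans fc (ltry c).
Qed.

Lemma integral_ge0Z c f : 0 <= c -> measurable_fun setT f ->
  (forall w, 0 <= f w) ->
  (\int[P]_w (c * f w)%:E = c%:E * \int[P]_w (f w)%:E)%E.
Proof.
move=> c0 mf f0.
transitivity (\int[P]_w (c%:E * (f w)%:E))%E.
  by apply: eq_integral => w _; rewrite EFinM.
apply: ge0_integralZl => //; first exact/measurable_EFinP.
by move=> w _; rewrite lee_fin.
Qed.

Lemma L1M f g : measurable_fun setT f -> measurable_fun setT g ->
  L1 (fun w => f w ^+ 2) -> L1 (fun w => g w ^+ 2) -> L1 (fun w => f w * g w).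
Proof.
move=> mf mg Lf Lg; apply: L1_le (L1D Lf Lg); first exact: measurable_funM.
move=> w; rewrite normrM; have := sqr_ge0 (`|f w| - `|g w|).
rewrite sqrrB !real_normK ?num_real//.
by have := sqr_ge0 (f w); have := sqr_ge0 (g w); nra.
Qed.

Lemma L1_of_sqr f : measurable_fun setT f ->
  L1 (fun w => f w ^+ 2) -> L1 f.
Proof.
move=> mf Lf; have := L1M mf (measurable_cst (1 : R)) Lf (L1_cst (1 ^+ 2)).
by apply: eq_integrable => // w _; rewrite /= mulr1.
Qed.

End integrable_real.

Section orthogonality.
Context d d' (T : measurableType d) (S : measurableType d') (R : realType).
Context (P : probability T R) (X : T -> S) (e : T -> R).
Hypotheses (mX : measurable_fun setT X) (Le : L1 P e).
Hypothesis e_ortho : forall B, measurable B ->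
  (\int[P]_(w in X @^-1` B) (e w)%:E = 0)%E.

Import HBNNSimple.

Let ortho_simple (u : {nnsfun S >-> R}) :
  (\int[P]_w (u (X w) * e w)%:E = 0)%E.
Proof.
pose s : seq R := finmap.enum_fset (fset_set (u @` setT)).
have L i : L1 P (fun w => \1_(u @^-1` [set s`_i]) (X w) * e w).
  apply: L1_le (integrable_norm Le).
    apply: measurable_funM; last exact: L1_measurable Le.
    by apply: (measurableT_comp _ mX); exact: measurable_indic.
  by move=> w /=; rewrite normrM ger0_norm// ler_piMl.
under eq_integral => w _.
  rewrite fimfunEord mulr_suml.
  under eq_bigr do rewrite -mulrA.
  over.
rewrite (integral_L1_sum (P := P)); last by move=> i; exact: L1Z (L i).
apply: big1 => i _; rewrite integral_L1Z ?L//.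
rewrite [X in (_ * X)%E](_ : _ = 0%E) ?mule0//.
rewrite -[RHS](e_ortho (B := u @^-1` [set s`_i]))//.
rewrite [RHS]integral_mkcond; apply: eq_integral => w _.
rewrite /patch indicE; case: ifPn => [/set_mem uw|/negP uw].
  by rewrite mem_set// mul1r.
by rewrite memNset ?mul0r// => ux; apply: uw; exact: mem_set.
Qed.

Let ortho_ge0 (h : S -> R) : measurable_fun setT h -> (forall x, 0 <= h x) ->
  L1 P (fun w => h (X w) * e w) -> (\int[P]_w (h (X w) * e w)%:E = 0)%E.
Proof.
move=> mh h0 Lhe.
have mh' : measurable_fun setT (EFin \o h) by exact/measurable_EFinP.
pose u := nnsfun_approx measurableT mh'.
have u_h x : (u m x @[m --> \oo] --> h x)%R.
  have /fine_cvgP[_]// : (EFin \o u^~ x) @ \oo --> (EFin \o h) x.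
  by apply: cvg_nnsfun_approx => // y _; rewrite lee_fin.
have u_le m x : u m x <= h x.
  have nd : nondecreasing_seq (u ^~ x).
    by move=> i j ij; exact/lefP/nd_nnsfun_approx.
  rewrite -(cvg_lim _ (u_h x))//; apply: nondecreasing_cvgn_le => //.
  exact: cvgP (u_h x).
have me := L1_measurable Le.
have muX m : measurable_fun setT (fun w => u m (X w)) by exact: measurableT_comp.
have mhX : measurable_fun setT (fun w => h (X w)) by exact: measurableT_comp.
have [|||||_ _] := @dominated_convergence _ _ _ P setT measurableT
   (fun m w => (u m (X w) * e w)%:E) (fun w => (h (X w) * e w)%:E)
   (fun w => `|h (X w) * e w|%:E).
- by move=> m; apply/measurable_EFinP; exact: measurable_funM.
- by apply/measurable_EFinP; exact: measurable_funM.
- apply: aeW => w _; apply: cvg_EFin; first exact: nearW.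
  by apply: cvgMr_tmp; exact: u_h.
- exact: integrable_norm.
- apply: aeW => w m _; rewrite /= lee_fin !normrM ler_wpM2r//.
  by rewrite !ger0_norm.
under eq_fun do rewrite ortho_simple.
by move=> /cvg_lim <-//; rewrite lim_cst.
Qed.

(** For a simple h the integral is a finite combination of the integrals of e
    over preimages. Nonnegative h are limits of simple ones below h, so that
    |h (X) e| dominates; a general h is the difference of its two parts
    max(h,0) and max(-h,0). *)
Lemma integral_comp_ortho (h : S -> R) : measurable_fun setT h ->
  L1 P (fun w => h (X w) * e w) -> (\int[P]_w (h (X w) * e w)%:E = 0)%E.
Proof.
move=> mh Lhe.
have part (k : S -> R) : measurable_fun setT k -> (forall x, 0 <= k x) ->
    (forall x, k x <= `|h x|) ->
    L1 P (fun w => k (X w) * e w) /\ (\int[P]_w (k (X w) * e w)%:E = 0)%E.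
  move=> mk k0 kh; have Lk : L1 P (fun w => k (X w) * e w).
    apply: L1_le (integrable_norm Lhe).
      by apply: measurable_funM; [exact: measurableT_comp|exact: L1_measurable Le].
    by move=> w; rewrite /= !normrM ler_wpM2r// ger0_norm.
  by split=> //; exact: ortho_ge0.
have [|||L1p Ip] := part (fun x => Num.max (h x) 0).
- exact: measurable_maxr.
- by move=> x; rewrite le_max lexx orbT.
- by move=> x; rewrite ge_max normr_ge0 ler_norm.
have [|||L1n In] := part (fun x => Num.max (- h x) 0).
- by apply: measurable_maxr => //; exact: measurable_funN.
- by move=> x; rewrite le_max lexx orbT.
- by move=> x; rewrite ge_max normr_ge0 -normrN ler_norm.
transitivity (\int[P]_w (Num.max (h (X w)) 0 * e w -
    Num.max (- h (X w)) 0 * e w)%:E)%E.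
  apply: eq_integral => w _; congr EFin; rewrite -mulrBl; congr (_ * _).
  by have [a|a] := leP (h (X w)) 0; have [b|b] := leP (- h (X w)) 0; lra.
by rewrite (integral_L1B L1p L1n) Ip In sube0.
Qed.

End orthogonality.

(** * Independence *)

Section freezing.
Context d d1 d2 (T : measurableType d) (S1 : measurableType d1)
  (S2 : measurableType d2) (R : realType) (P : probability T R).
Context (X : T -> S1) (Z : T -> S2).
Hypotheses (mX : measurable_fun setT X) (mZ : measurable_fun setT Z).
Hypothesis XZ_indep : forall A B, measurable A -> measurable B ->
  P (X @^-1` A `&` Z @^-1` B) = (P (X @^-1` A) * P (Z @^-1` B))%E.

Let Xf : {mfun T >-> S1} := HB.pack X (isMeasurableFun.Build _ _ _ _ _ mX).
Let Zf : {mfun T >-> S2} := HB.pack Z (isMeasurableFun.Build _ _ _ _ _ mZ).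
Let mXZ : measurable_fun setT (fun w => (X w, Z w)) := measurable_fun_pair mX mZ.
Let XZf : {mfun T >-> (S1 * S2)%type} :=
  HB.pack (fun w => (X w, Z w)) (isMeasurableFun.Build _ _ _ _ _ mXZ).

Context (phi : S1 * S2 -> \bar R).
Hypotheses (mphi : measurable_fun setT phi) (phi0 : forall p, (0 <= phi p)%E).

Lemma freezing_measurable :
  measurable_fun setT (fun x => \int[P]_w phi (x, Z w))%E.
Proof.
have := measurable_fun_fubini_tonelli_F (m2 := distribution P Zf) _ mphi phi0.
apply: eq_measurable_fun => x _; rewrite /fubini_F ge0_integral_distribution//.
exact: measurableT_comp.
Qed.

(** Under independence the law of the pair (X, Z) is the product of the two
    laws, and Tonelli's theorem applies. *)
Lemma freezing :
  (\int[P]_w phi (X w, Z w) = \int[P]_w \int[P]_w' phi (X w, Z w'))%E.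
Proof.
transitivity (\int[distribution P XZf]_p phi p)%E.
  by rewrite ge0_integral_distribution.
transitivity (\int[distribution P Xf \x distribution P Zf]_p phi p)%E.
  apply: eq_measure_integral => A mA _; apply/esym.
  exact: product_measure_unique.
rewrite fubini_tonelli1// ge0_integral_distribution//; last 2 first.
- exact: measurable_fun_fubini_tonelli_F.
- by move=> x; exact: integral_ge0.
apply: eq_integral => w _; rewrite /= /fubini_F ge0_integral_distribution//.
exact: measurableT_comp.
Qed.

End freezing.

Section grouping.
Context (R : realType) d (T : measurableType d) (P : probability T R).

(** Uniqueness of finite measures on pi-systems, used once for each of the two
    systems. *)
Lemma independent_sigma (G H : set (set T)) :
  G `<=` measurable -> H `<=` measurable ->
  setI_closed G -> setI_closed H -> G setT -> H setT ->
  independent_systems P G H -> independent_systems P <<s G >> <<s H >>.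
Proof.
move=> mG mH GI HI GT HT.
(* For a fixed second event, both sides are finite measures in the first. *)
have fix_second (G0 H0 : set (set T)) : G0 `<=` measurable -> H0 `<=` measurable ->
    setI_closed G0 -> G0 setT ->
    independent_systems P G0 H0 -> independent_systems P <<s G0 >> H0.
  move=> mG0 mH0 G0I G0T GH0 A B sA HB; have mB := mH0 _ HB.
  have PB : P B \is a fin_num by rewrite fin_num_measure.
  pose c : {nonneg R} := NngNum (fine_ge0 (measure_ge0 P B)).
  have E (C : set T) : mscale c P C = (P C * P B)%E.
    by rewrite /mscale /= fineK// muleC.
  rewrite -E -[LHS]/(mrestr P mB A).
  apply: (@g_sigma_algebra_measure_unique _ _ _ G0 mG0 (fun=> setT)) => //.
  - by rewrite bigcup_const.
  - by move=> C GC; exact: etrans (GH0 _ _ GC HB) (esym (E C)).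
  - by move=> _; rewrite /= /mrestr setTI ltey_eq PB.
move=> GH; apply: (fix_second G <<s H >>) => //.
  by apply: smallest_sub => //; exact: sigma_algebra_measurable.
have HG : independent_systems P <<s H >> G.
  by apply: (fix_second H G) => // B A HB GA; rewrite setIC muleC GH.
by move=> A B GA sB; rewrite setIC muleC HG.
Qed.

Context (I : eqType) d' (S : measurableType d') (X : I -> T -> S).
Hypotheses (mX : forall i, measurable_fun setT (X i)).

Definition preimages (A : set I) : set (set T) :=
  \bigcup_(i in A) g_sigma_algebra_preimage (X i).

Lemma preimages_measurable A : preimages A `<=` measurable.
Proof. by move=> _ [i _ [B mB <-]]; exact: mX. Qed.

(** The events that constrain finitely many members of a subfamily form a
    pi-system generating its sigma-algebra. For disjoint subfamilies, the
    product rule on the concatenation of the two index lists is independence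
    of the two pi-systems. *)
Lemma grouping (A B : set I) : mutually_independent P X -> A `&` B = set0 ->
  independent_systems P <<s preimages A >> <<s preimages B >>.
Proof.
move=> XI AB.
pose cyl (A : set I) : set (set T) := [set C | exists (s : seq I) (E : I -> set S),
  [/\ uniq s, (forall i, i \in s -> A i), (forall i, measurable (E i)) &
   C = \bigcap_(i in [set` s]) (X i @^-1` E i)]].
have cyl_measurable A0 : cyl A0 `<=` measurable.
  move=> _ [s [E [_ _ mE ->]]]; apply: fin_bigcap_measurable => // i _.
  by rewrite -[X in measurable X]setTI; exact: mX.
have cylI A0 : setI_closed (cyl A0).
  move=> _ _ [s [E [us sA mE ->]]] [t [F [ut tA mF ->]]].
  exists (undup (s ++ t)), (fun i => (if i \in s then E i else setT) `&`
    (if i \in t then F i else setT)); split.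
  - exact: undup_uniq.
  - by move=> i; rewrite mem_undup mem_cat => /orP[/sA|/tA].
  - by move=> i; apply: measurableI; case: ifP.
  apply/seteqP; split=> [w [ws wt] i _ /=|w H].
    by split; case: ifP => // ?; [exact: ws|exact: wt].
  split=> i /= si; have := H i; rewrite /= mem_undup mem_cat si ?orbT => /(_ isT).
    by case.
  by case.
have cylT A0 : cyl A0 setT.
  by exists [::], (fun=> setT); split => //; rewrite set_nil bigcap_set0.
have sub A0 : <<s preimages A0 >> `<=` <<s cyl A0 >>.
  apply: smallest_sub; first exact: smallest_sigma_algebra.
  move=> _ [i Ai [C mC <-]]; apply: sub_sigma_algebra.
  exists [:: i], (fun=> C); split => //; first by move=> j; rewrite inE => /eqP ->.
  by rewrite set_cons1 bigcap_set1 setTI.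
suff H : independent_systems P <<s cyl A >> <<s cyl B >>.
  by move=> U V /sub HU /sub; exact: H.
apply: independent_sigma => //.
move=> _ _ [s [E [us sA mE ->]]] [t [F [ut tB mF ->]]].
have disj i : i \in s -> i \in t -> False.
  by move=> /sA Ai /tB Bi; have : (A `&` B) i by []; rewrite AB.
pose K i := if i \in s then E i else F i.
have -> : \bigcap_(i in [set` s]) (X i @^-1` E i) =
    \bigcap_(i in [set` s]) (X i @^-1` K i).
  by apply: eq_bigcapr => i /= si; rewrite /K si.
have -> : \bigcap_(i in [set` t]) (X i @^-1` F i) =
    \bigcap_(i in [set` t]) (X i @^-1` K i).
  apply: eq_bigcapr => i /= ti; rewrite /K ifF//; apply/negP => si.
  exact: disj si ti.
have mK i : measurable (K i) by rewrite /K; case: ifP.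
have set_cat : [set` s] `|` [set` t] = [set` s ++ t].
  by apply/seteqP; split=> i /=; rewrite mem_cat => /orP.
rewrite -bigcap_setU set_cat !XI// ?big_cat//.
rewrite cat_uniq us ut andbT /=; apply/hasPn => i it; apply/negP => si.
exact: disj si it.
Qed.

End grouping.

(** * Sampling an index uniformly *)

Section uniform_sampling.
Context (R : realType) d (T : measurableType d) (P : probability T R).
Context (N : nat) (J : T -> nat) (F : set (set T)).
Hypotheses (N_gt0 : (0 < N)%N) (J_unif : uniform_index P N J F).

Let JE k : measurable (J @^-1` [set k]).
Proof. by case: J_unif => mJ _ _; rewrite -[X in measurable X]setTI; exact: mJ. Qed.

Let JP k : (k < N)%N -> P (J @^-1` [set k]) = (N%:R^-1)%:E.
Proof. by case: J_unif => _ + _; exact. Qed.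

Let one_index w : \sum_(k < N) \1_(J @^-1` [set (k : nat)]) w = (J w < N)%N%:R :> R.
Proof.
have [JN|JN] := ltnP (J w) N.
  rewrite (bigD1 (Ordinal JN))//= indicE mem_set// big1 ?addr0// => k kJ.
  rewrite indicE memNset// => /= Jk; move: kJ; rewrite -val_eqE /= Jk.
  by rewrite eqxx.
rewrite big1// => k _; rewrite indicE memNset// => /= Jk.
by move: JN; rewrite Jk leqNgt ltn_ord.
Qed.

(** The events J = k for k < N have total probability N (1/N) = 1; outside of
    them the value of J is unconstrained. *)
Lemma uniform_index_lt : {ae P, forall w, (J w < N)%N}.
Proof.
have mlt : measurable [set w | (J w < N)%N].
  have -> : [set w | (J w < N)%N] = \bigcup_(k in `I_N) J @^-1` [set k].
    by apply/seteqP; split=> [w /= ?|w [k /= kN Jk]]; [exists (J w)|rewrite Jk].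
  exact: bigcup_measurable.
exists (~` [set w | (J w < N)%N]); split => //; first exact: measurableC.
rewrite probability_setC// (_ : P _ = 1%E) ?subee//.
rewrite -[X in P X]setIT -integral_indic//.
transitivity (\int[P]_w (\sum_(k < N) \1_(J @^-1` [set (k : nat)]) w)%:E)%E.
  apply: eq_integral => w _; rewrite one_index indicE.
  rewrite (_ : (w \in _) = (J w < N)%N)//.
  by apply/idP/idP; rewrite inE.
rewrite integral_L1_sum; last by move=> i; exact: integrable_indic.
transitivity (\sum_(k < N) (N%:R^-1 : R)%:E)%E.
  by apply: eq_bigr => k _; rewrite integral_indic// setIT; exact: JP.
rewrite sumEFin sumr_const card_ord -[_ *+ _]mulr_natl divff//.
by rewrite pnatr_eq0 -lt0n.
Qed.

(** The centred indicator of J = k has integral 0 over every event of F, hence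
    is orthogonal to h (X k). *)
Lemma uniform_index_mean d' (S : measurableType d') (X : nat -> T -> S)
    (h : S -> R) :
  (forall k, measurable_fun setT (X k)) ->
  (forall k B, measurable B -> F (X k @^-1` B)) ->
  measurable_fun setT h -> (forall k, L1 P (fun w => h (X k w))) ->
  (\int[P]_w (h (X (J w) w))%:E =
   \sum_(k < N) (N%:R^-1)%:E * \int[P]_w (h (X k w))%:E)%E.
Proof.
move=> mX FX mh Lh.
have mhX k : measurable_fun setT (fun w => h (X k w)) by exact: measurableT_comp.
have Li (A : set T) k : measurable A -> L1 P (fun w => h (X k w) * \1_A w).
  move=> mA; apply: L1_le (integrable_norm (Lh k)).
    by apply: measurable_funM => //; exact: measurable_indic.
  by move=> w; rewrite /= normrM [`|\1_A w|]ger0_norm// ler_piMr.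
have mJX : measurable_fun setT (fun w => h (X (J w) w)).
  move=> _ B mB; rewrite setTI.
  have -> : (fun w => h (X (J w) w)) @^-1` B =
      \bigcup_k (J @^-1` [set k] `&` (fun w => h (X k w)) @^-1` B).
    by apply/seteqP; split=> [w ?|w [k _ [/= <-]]//]; exists (J w).
  apply: bigcupT_measurable => k; apply: measurableI => //.
  by rewrite -[X in measurable X]setTI; exact: mhX.
transitivity (\int[P]_w (\sum_(k < N) h (X k w) * \1_(J @^-1` [set (k : nat)]) w)%:E)%E.
  apply: ae_eq_integral => //.
  - exact/measurable_EFinP.
  - apply/measurable_EFinP; apply: measurable_sum => k.
    by apply: measurable_funM => //; exact: measurable_indic.
  apply: filterS uniform_index_lt => w JN _; congr EFin.
  rewrite (bigD1 (Ordinal JN))//= indicE mem_set// mulr1 big1 ?addr0// => k kJ.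
  rewrite indicE memNset ?mulr0// => /= Jk; move: kJ; rewrite -val_eqE /= Jk.
  by rewrite eqxx.
rewrite integral_L1_sum; last by move=> i; exact: Li.
apply: eq_bigr => k _; rewrite -integral_L1Z//.
set A := J @^-1` _; have mA : measurable A by exact: JE.
have Le : L1 P (fun w => \1_A w - N%:R^-1).
  by apply: L1B; [exact: integrable_indic|exact: L1_cst].
have L1he : L1 P (fun w => h (X k w) * (\1_A w - N%:R^-1)).
  have := L1B (Li _ k mA) (L1Z N%:R^-1 (Lh k)).
  by apply: eq_integrable => // w _; rewrite /= mulrBr [h _ * N%:R^-1]mulrC.
have := integral_comp_ortho (mX k) Le _ mh L1he.
have E : (\int[P]_w (h (X k w) * (\1_A w - N%:R^-1))%:E =
    \int[P]_w (h (X k w) * \1_A w)%:E -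
    \int[P]_w (N%:R^-1 * h (X k w))%:E)%E.
  rewrite -(integral_L1B (Li _ k mA) (L1Z N%:R^-1 (Lh k))).
  by apply: eq_integral => w _; rewrite mulrBr [h _ * N%:R^-1]mulrC.
rewrite E => H.
have fin : (\int[P]_w (N%:R^-1 * h (X k w))%:E)%E \is a fin_num.
  exact: (integrable_fin_num measurableT (L1Z N%:R^-1 (Lh k))).
rewrite -[LHS](@subeK _ _ (\int[P]_w (N%:R^-1 * h (X k w))%:E)%E)// H ?add0e//.
move=> B mB.
have mXB : measurable (X k @^-1` B).
  by rewrite -[X in measurable X]setTI; exact: mX.
have PAB : P (A `&` X k @^-1` B) = ((N%:R^-1)%:E * P (X k @^-1` B))%E.
  have [_ _ JF] := J_unif; rewrite JF; first by rewrite JP.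
    by exists [set (k : nat)]; rewrite ?setTI.
  exact: FX.
have -> : (\int[P]_(w in X k @^-1` B) (\1_A w - N%:R^-1)%:E =
  \int[P]_(w in X k @^-1` B) (\1_A w)%:E -
  \int[P]_(w in X k @^-1` B) (N%:R^-1)%:E)%E.
  rewrite -integralB//.
    by apply: integrableS (integrable_indic _ mA) => //.
  by apply: integrableS (L1_cst P N%:R^-1) => //.
rewrite integral_indic// integral_cst//.
by rewrite [X in (X - _)%E]PAB subee// fin_numM// fin_num_measure.
Qed.

End uniform_sampling.

(** * Convergence under conditional estimator hypotheses *)

Section square_integrable.
Context (R : realType) (n : nat) d (T : measurableType d) (P : probability T R).
Implicit Types X Y : T -> 'rV[R]_n.

(** Measurability is included because that of the square does not give it. *)
Definition L2vec X := forall i,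
  measurable_fun setT (fun w => X w ord0 i) /\
  L1 P (fun w => X w ord0 i ^+ 2).

Lemma L2vec_measurable X : L2vec X -> measurable_fun setT (X : T -> borelRn R n).
Proof. by move=> LX; apply: measurable_borelRn => i; exact: (LX i).1. Qed.

Lemma L2vec_cst (a : 'rV[R]_n) : L2vec (fun=> a).
Proof. by move=> i; split=> //; exact: L1_cst. Qed.

Lemma L1_dot X Y : L2vec X -> L2vec Y -> L1 P (fun w => dot (X w) (Y w)).
Proof.
move=> LX LY; apply: L1_sum => i; apply: L1M.
- exact: (LX i).1.
- exact: (LY i).1.
- exact: (LX i).2.
- exact: (LY i).2.
Qed.

Lemma L1_enorm_sqr X : L2vec X -> L1 P (fun w => enorm (X w) ^+ 2).
Proof. by move=> LX; under eq_fun do rewrite enorm_sqr; exact: L1_dot. Qed.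

Lemma measurable_enorm_sqr X : measurable_fun setT (X : T -> borelRn R n) ->
  measurable_fun setT (fun w => enorm (X w) ^+ 2).
Proof.
move=> mX; under eq_fun do rewrite enorm_sqr.
by apply: measurable_dot => i; exact: measurable_coord.
Qed.

Lemma L2vec_enorm X : measurable_fun setT (X : T -> borelRn R n) ->
  L1 P (fun w => enorm (X w) ^+ 2) -> L2vec X.
Proof.
move=> mX LX i; have mXi := measurable_coord i mX; split=> //.
apply: L1_le LX; first exact: measurable_funX.
by move=> w; rewrite ger0_norm ?sqr_ge0// coord_sqr_le.
Qed.

Lemma L2vecD X Y : L2vec X -> L2vec Y -> L2vec (fun w => X w + Y w).
Proof.
move=> LX LY i; have [mX X2] := LX i; have [mY Y2] := LY i.
under eq_fun do rewrite mxE.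
under [X in L1 P X]eq_fun do rewrite mxE.
split; first exact: measurable_funD.
apply: L1_le (L1Z 2 (L1D X2 Y2)).
  by apply: measurable_funX; exact: measurable_funD.
move=> w; rewrite ger0_norm ?sqr_ge0//.
set a := X w _ _; set b := Y w _ _.
by have := sqr_ge0 (a - b); rewrite sqrrB sqrrD; lra.
Qed.

Lemma L2vecZ c X : L2vec X -> L2vec (fun w => c *: X w).
Proof.
move=> LX i; have [mX X2] := LX i.
under eq_fun do rewrite mxE.
under [X in L1 P X]eq_fun do rewrite mxE exprMn.
by split; [exact: measurable_funM|exact: L1Z].
Qed.

Lemma L2vecB X Y : L2vec X -> L2vec Y -> L2vec (fun w => X w - Y w).
Proof.
move=> LX /(L2vecZ (-1)) LY; have := L2vecD LX LY.
by under eq_fun do rewrite scaleN1r.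
Qed.

(** The Lipschitz bound compares the gradient at X with the gradient at 0. *)
Lemma L2vec_grad (f : 'rV[R]_n -> R) (L : R) X : 0 < L -> L_smooth L f ->
  L2vec X -> L2vec (fun w => grad f (X w)).
Proof.
move=> L0 fs LX; pose Y w := grad f (X w) - grad f 0.
have mg i : measurable_fun setT (fun w => grad f (X w) ord0 i).
  apply: (@measurableT_comp _ _ _ _ _ _
    ((fun y => grad f y ord0 i) : borelRn R n -> R) _ (X : T -> borelRn R n)).
    by apply: continuous_borelRn; exact: grad_coord_continuous L0 fs i.
  exact: L2vec_measurable.
have mY : measurable_fun setT (Y : T -> borelRn R n).
  apply: measurable_borelRn => i; under eq_fun do rewrite mxE.
  exact: measurable_funD.
suff LY : L2vec Y.
  have := L2vecD LY (L2vec_cst (grad f 0)).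
  by under eq_fun do rewrite subrK.
apply: L2vec_enorm => //.
apply: L1_le (L1Z (L ^+ 2) (L1_enorm_sqr LX)).
  exact: measurable_enorm_sqr.
move=> w; rewrite ger0_norm ?sqr_ge0// -exprMn /Y.
have := fs.2 (X w) 0; rewrite subr0 => H.
by rewrite ler_pXn2r ?nnegrE ?enorm_ge0// (le_trans (enorm_ge0 _) H).
Qed.

End square_integrable.

Section conditional_estimator.
Context (R : realType) (n : nat) d (T : measurableType d) (P : probability T R).
Context (f : 'rV[R]_n -> R) (L v : R) (x g : T -> 'rV[R]_n).
Hypotheses (L_gt0 : 0 < L) (f_smooth : L_smooth L f) (Lx : L2vec P x).
Hypothesis mg : measurable_fun setT (g : T -> borelRn R n).
Hypothesis gx : gradient_estimator_given P f v x g.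

Let noise w := g w - grad f (x w).

Let mnoise : measurable_fun setT (noise : T -> borelRn R n).
Proof.
have LG := L2vec_grad L_gt0 f_smooth Lx.
apply: measurable_borelRn => i; under eq_fun do rewrite !mxE.
apply: measurable_funB; first exact: measurable_coord.
by have := (LG i).1; under eq_fun do rewrite mxE.
Qed.

Lemma noise_L2vec : L2vec P noise.
Proof.
have [_ [Y [[iE _ _ _] _]]] := gx.
exact: L2vec_enorm.
Qed.

Lemma estimator_L2vec : L2vec P g.
Proof.
have := L2vecD noise_L2vec (L2vec_grad L_gt0 f_smooth Lx).
by rewrite /noise; under eq_fun do rewrite subrK.
Qed.

(** The conditional variance Y has the same integral as the squared noise, but
    Y <= v holds almost surely only, hence the detour through min(Y, v). *)
Lemma noise_variance : (\int[P]_w (enorm (noise w) ^+ 2)%:E <= v%:E)%E.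
Proof.
have [_ [Y [[iE iY _ EY] Yv]]] := gx.
rewrite EY; last by exists setT => //; rewrite setTI.
have mY := L1_measurable iY.
have mmin : measurable_fun setT (fun w => Num.min (Y w) v).
  exact: measurable_minr.
have Lmin : L1 P (fun w => Num.min (Y w) v).
  apply: L1_le (L1D (integrable_norm iY) (L1_cst P `|v|)) => // w /=.
  by have := normr_ge0 (Y w); have := normr_ge0 v; case: (leP (Y w) v) => _; lra.
rewrite (@ae_eq_integral _ _ _ _ _ (fun w => (Num.min (Y w) v)%:E))//.
- rewrite (le_trans (le_integral (g := fun=> v%:E) measurableT Lmin _ _))//.
  + exact: L1_cst.
  + by move=> w _ /=; rewrite lee_fin ge_min lexx orbT.
  + by rewrite integral_cst// [X in (_ * X)%E]probability_setT mule1.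
- exact/measurable_EFinP.
- exact/measurable_EFinP.
- by apply: filterS Yv => w Yvw _; rewrite min_l.
Qed.

(** Coordinatewise, the conditional mean hypothesis says that the noise has
    integral 0 over every event of the sigma-algebra of x. *)
Lemma noise_orthogonal :
  (\int[P]_w (dot (grad f (x w)) (noise w))%:E = 0)%E.
Proof.
have LG := L2vec_grad L_gt0 f_smooth Lx.
rewrite integral_L1_sum; last first.
  move=> i; apply: L1M.
  - exact: (LG i).1.
  - exact: (noise_L2vec i).1.
  - exact: (LG i).2.
  - exact: (noise_L2vec i).2.
apply: big1 => i _; have [cond _] := gx; have [ig iG _ E] := cond i.
have Ln : L1 P (fun w => noise w ord0 i).
  by apply: L1_of_sqr; [exact: (noise_L2vec i).1|exact: (noise_L2vec i).2].
apply: (@integral_comp_ortho _ _ _ (borelRn R n) _ _ x _ _ Ln _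
  (fun y => grad f y ord0 i)).
- exact: L2vec_measurable.
- move=> B mB; have mxB : measurable (x @^-1` B).
    rewrite -[X in measurable X]setTI.
    exact: (L2vec_measurable Lx).
  have iS (h : T -> R) : L1 P h -> P.-integrable (x @^-1` B) (EFin \o h).
    by move=> Lh; apply: integrableS Lh.
  transitivity (\int[P]_(w in x @^-1` B) (g w ord0 i)%:E -
     \int[P]_(w in x @^-1` B) (grad f (x w) ord0 i)%:E)%E.
    rewrite -integralB; [|by []|exact: iS|exact: iS].
    by apply: eq_integral => w _; rewrite /= !mxE.
  rewrite E; last by exists B => //; rewrite setTI.
  rewrite subee//; exact: (integrable_fin_num mxB (iS _ iG)).
- by apply: continuous_borelRn; exact: grad_coord_continuous L_gt0 f_smooth i.
- apply: L1M.
  - exact: (LG i).1.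
  - exact: (noise_L2vec i).1.
  - exact: (LG i).2.
  - exact: (noise_L2vec i).2.
Qed.

End conditional_estimator.

Section convergence.
Context (R : realType) (n : nat) d (T : measurableType d) (P : probability T R).
Context (f : 'rV[R]_n -> R) (L fstar v : R) (x0 : 'rV[R]_n).
Hypotheses (L_gt0 : 0 < L) (f_smooth : L_smooth L f).
Hypothesis f_lb : forall y, fstar <= f y.
Context (x g : nat -> T -> 'rV[R]_n).
Hypothesis sgd_xg : sgd_process P f L v x0 x g.

(** The noise is square-integrable by the variance hypothesis and the gradient
    because it is Lipschitz, so each step preserves square-integrability. *)
Lemma sgd_L2vec k : L2vec P (x k).
Proof.
have [xE0 xE mg gg] := sgd_xg; elim: k => [|k IH].
  have -> : x 0%N = (fun=> x0) by exact/funext.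
  exact: L2vec_cst.
have -> : x k.+1 = (fun w => x k w - (1 / (2 * L)) *: g k w) by exact/funext.
apply: L2vecB => //; apply: L2vecZ.
exact: (estimator_L2vec L_gt0 f_smooth IH (mg k) (gg k)).
Qed.

Let G k w := grad f (x k w).
Let noise k w := g k w - G k w.

Let LG k : L2vec P (G k).
Proof. exact: L2vec_grad L_gt0 f_smooth (sgd_L2vec k). Qed.

Let Lnoise k : L2vec P (noise k).
Proof.
have [_ _ mg gg] := sgd_xg.
exact: (noise_L2vec L_gt0 f_smooth (sgd_L2vec k) (mg k) (gg k)).
Qed.

(** The sum of the one-step inequalities, multiplied by 8L/3, for a fixed
    outcome w. *)
Lemma sgd_path N w :
  \sum_(k < N) enorm (G k w) ^+ 2 <=
  8 * L / 3 * (f x0 - fstar) + \sum_(k < N)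
    (- (2 / 3) * dot (G k w) (noise k w) + 1 / 3 * enorm (noise k w) ^+ 2).
Proof.
have [xE0 xE _ _] := sgd_xg.
suff : \sum_(k < N) enorm (G k w) ^+ 2 <=
  8 * L / 3 * (f x0 - f (x N w)) + \sum_(k < N)
    (- (2 / 3) * dot (G k w) (noise k w) + 1 / 3 * enorm (noise k w) ^+ 2).
  move/le_trans; apply; rewrite lerD2r ler_pM2l ?lerB//.
  by rewrite divr_gt0// mulr_gt0.
elim: N => [|N IH]; first by rewrite !big_ord0 xE0 subrr mulr0 addr0.
rewrite !big_ord_recr /=; have := sgd_step_descent L_gt0 f_smooth (x N w) (g N w).
rewrite -xE -/(G N w) -/(noise N w).
move: IH; set A := \sum_(_ < _) _; set B := \sum_(_ < _) _.
set a := enorm _ ^+ 2; set b := dot _ _; set c := enorm _ ^+ 2.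
set y := f (x N w); set z := f (x N.+1 w) => IH H.
have := ler_wpM2l (ltW L_gt0) H.
have -> : L * (3 / (8 * L) * a) = 3 / 8 * a by field; rewrite gt_eqF.
have -> : L * (y - z - 1 / (4 * L) * b + 1 / (8 * L) * c) =
  L * y - L * z - 1 / 4 * b + 1 / 8 * c by field; rewrite gt_eqF.
by move: IH; set u := f x0; lra.
Qed.

Lemma sgd_mean_sum N :
  (\sum_(k < N) \int[P]_w (enorm (G k w) ^+ 2)%:E <=
   (8 * L / 3 * (f x0 - fstar) + N%:R * (1 / 3 * v))%:E)%E.
Proof.
have [_ _ mg gg] := sgd_xg.
have Ld k : L1 P (fun w => - (2 / 3) * dot (G k w) (noise k w)).
  by apply: L1Z; exact: L1_dot.
have Le k : L1 P (fun w => 1 / 3 * enorm (noise k w) ^+ 2).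
  by apply: L1Z; exact: L1_enorm_sqr.
have Lk k : L1 P (fun w => - (2 / 3) * dot (G k w) (noise k w) +
    1 / 3 * enorm (noise k w) ^+ 2) by exact: L1D.
rewrite -integral_L1_sum; last by move=> k; exact: L1_enorm_sqr.
apply: (le_trans (le_integral (g := fun w => (8 * L / 3 * (f x0 - fstar) +
  \sum_(k < N) (- (2 / 3) * dot (G k w) (noise k w) +
    1 / 3 * enorm (noise k w) ^+ 2))%:E) measurableT _ _ _)).
- by apply: L1_sum => k; exact: L1_enorm_sqr.
- by apply: L1D; [exact: L1_cst|apply: L1_sum].
- by move=> w _; rewrite lee_fin sgd_path.
rewrite integral_L1D; [|exact: L1_cst|by apply: L1_sum].
rewrite integral_cst// [X in (_ * X)%E]probability_setT mule1 EFinD leeD2l//.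
rewrite integral_L1_sum//.
apply: (@le_trans _ _ (\sum_(k < N) (1 / 3 * v)%:E)%E).
  apply: lee_sum => k _; rewrite integral_L1D// !integral_L1Z//.
  - rewrite (noise_orthogonal L_gt0 f_smooth (sgd_L2vec k) (mg k) (gg k)) mule0 add0e.
    rewrite [leRHS]EFinM lee_wpmul2l//.
    exact: noise_variance (gg k).
  - exact: L1_enorm_sqr.
  - exact: L1_dot.
by rewrite sumEFin sumr_const card_ord mulr_natl.
Qed.

Context (N : nat) (J : T -> nat) (F : set (set T)).
Hypotheses (N_gt0 : (0 < N)%N) (J_unif : uniform_index P N J F).
Hypothesis Fx : forall k (B : set (borelRn R n)),
  measurable B -> F (x k @^-1` B).

Lemma sgd_mean_sq_grad :
  (mean_sq_grad P f x J <= (8 * L / 3 * (f x0 - fstar) / N%:R + v / 3)%:E)%E.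
Proof.
have N0 : 0 < N%:R :> R by rewrite ltr0n.
rewrite /mean_sq_grad unlock.
rewrite (@uniform_index_mean _ _ _ _ _ _ _ N_gt0 J_unif _ (borelRn R n) x
  (fun y => enorm (grad f y) ^+ 2))//.
- rewrite -ge0_sume_distrr; last first.
    by move=> k _; apply: integral_ge0 => w _; rewrite lee_fin sqr_ge0.
  apply: (le_trans (lee_wpmul2l _ (sgd_mean_sum N))).
    by rewrite lee_fin invr_ge0 ltW.
  rewrite -EFinM lee_fin; move: N0; move: (N%:R : R) => r r0.
  rewrite le_eqVlt; apply/orP; left; apply/eqP.
  by field; rewrite gt_eqF.
- by move=> k; exact: L2vec_measurable (sgd_L2vec k).
- apply: (@measurable_enorm_sqr _ _ _ (borelRn R n) (grad f)).
  apply: measurable_borelRn => i; apply: continuous_borelRn.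
  exact: grad_coord_continuous L_gt0 f_smooth i.
- by move=> k; exact: L1_enorm_sqr (LG k).
Qed.

End convergence.

(** * Estimators driven by fresh independent randomness *)

Section fresh_estimator.
Context (R : realType) (n : nat) d dS (T : measurableType d)
  (S : measurableType dS) (P : probability T R).
Context (f : 'rV[R]_n -> R) (L v : R).
Context (X : T -> 'rV[R]_n) (Z : T -> S) (G : 'rV[R]_n -> S -> 'rV[R]_n).
Hypotheses (L_gt0 : 0 < L) (f_smooth : L_smooth L f) (LX : L2vec P X).
Hypothesis mZ : measurable_fun setT Z.
Hypothesis mG : measurable_fun setT
  ((fun p => G p.1 p.2) : (borelRn R n * S)%type -> borelRn R n).
Hypothesis XZ_indep : forall (A : set (borelRn R n)) B,
  measurable A -> measurable B ->
  P (X @^-1` A `&` Z @^-1` B) = (P (X @^-1` A) * P (Z @^-1` B))%E.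
Hypothesis G_estimator : gradient_estimator P f v (fun y w => G y (Z w)).

Let mX : measurable_fun setT (X : T -> borelRn R n) := L2vec_measurable LX.

Let mgrad i : measurable_fun setT ((fun y => grad f y ord0 i) : borelRn R n -> R).
Proof. by apply: continuous_borelRn; exact: grad_coord_continuous L_gt0 f_smooth i. Qed.

Let integral_preimage (B : set (borelRn R n)) (h : T -> \bar R) :
  (\int[P]_(w in X @^-1` B) h w = \int[P]_w ((\1_B (X w))%:E * h w))%E.
Proof.
rewrite integral_mkcond; apply: eq_integral => w _.
rewrite /patch indicE; case: ifPn => [/set_mem XB|/negP XB].
  by rewrite mem_set// mul1e.
by rewrite memNset ?mul0e// => XB'; apply: XB; exact: mem_set.
Qed.

Let noise (p : (borelRn R n * S)%type) : 'rV[R]_n := G p.1 p.2 - grad f p.1.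

Let mnoise_coord i : measurable_fun setT (fun p => noise p ord0 i).
Proof.
under eq_fun do rewrite !mxE.
apply: measurable_funB; first exact: measurable_coord mG.
have := measurableT_comp (mgrad i) (@measurable_fst _ _ (borelRn R n) S).
by under eq_fun do rewrite /= mxE.
Qed.

Let mnoise : measurable_fun setT (noise : _ -> borelRn R n).
Proof. by apply: measurable_borelRn; exact: mnoise_coord. Qed.

Let mXZ : measurable_fun setT (fun w => (X w : borelRn R n, Z w)).
Proof. exact: measurable_fun_pair. Qed.

Let sq p := enorm (noise p) ^+ 2.

Let msq : measurable_fun setT sq.
Proof. exact: measurable_enorm_sqr. Qed.

Let V y : \bar R := (\int[P]_w (sq (y, Z w))%:E)%E.

Let V_ge0 y : (0 <= V y)%E.
Proof. by apply: integral_ge0 => w _; rewrite lee_fin sqr_ge0. Qed.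

Let V_le y : (V y <= v%:E)%E.
Proof. by have := (G_estimator y).2; rewrite unlock. Qed.

Let V_fin y : V y \is a fin_num.
Proof. by rewrite ge0_fin_numE// (le_lt_trans (V_le y)) ?ltry. Qed.

Let mV : measurable_fun setT (V : borelRn R n -> \bar R).
Proof.
apply: (freezing_measurable P mZ (phi := fun p => (sq p)%:E)) => //.
  exact/measurable_EFinP.
by move=> p; rewrite lee_fin sqr_ge0.
Qed.

Let integral_sq (B : set (borelRn R n)) : measurable B ->
  (\int[P]_(w in X @^-1` B) (sq (X w, Z w))%:E =
   \int[P]_(w in X @^-1` B) V (X w))%E.
Proof.
move=> mB; rewrite !integral_preimage.
under eq_integral do rewrite -EFinM.
have m1 : measurable_fun setT (fun p : (borelRn R n * S)%type => \1_B p.1 * sq p).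
  apply: measurable_funM => //.
  by apply: (@measurableT_comp _ _ _ _ _ _ (\1_B : borelRn R n -> R) _ fst).
rewrite (freezing mX mZ XZ_indep (phi := fun p => (\1_B p.1 * sq p)%:E)).
- apply: eq_integral => w _; rewrite /= integral_ge0Z//.
    apply: (measurableT_comp msq); exact: measurable_fun_pair.
  by move=> w'; rewrite sqr_ge0.
- exact/measurable_EFinP.
- by move=> p; rewrite lee_fin mulr_ge0 ?sqr_ge0.
Qed.

Let L1sq : L1 P (fun w => sq (X w, Z w)).
Proof.
apply: (@ge0_L1 _ _ _ _ _ v).
- exact: (measurableT_comp msq mXZ).
- by move=> w; exact: sqr_ge0.
have := integral_sq (@measurableT _ (borelRn R n)).
rewrite preimage_setT => ->.
apply: (@le_trans _ _ (\int[P]_w v%:E)%E).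
  apply: ge0_le_integral.
  - exact: measurableT.
  - by move=> w _; exact: V_ge0.
  - exact: (measurableT_comp mV mX).
  - exact: measurable_cst.
  - by move=> w _; exact: V_le.
by rewrite integral_cst// [X in (_ * X)%E]probability_setT mule1.
Qed.

Let Lnoise : L2vec P (fun w => noise (X w, Z w)).
Proof. by apply: L2vec_enorm => //; exact: (measurableT_comp mnoise mXZ). Qed.

Let mean_noise_part y i : L1 P (fun w => noise (y, Z w) ord0 i) /\
  (\int[P]_w (Num.max (noise (y, Z w) ord0 i) 0)%:E =
   \int[P]_w (Num.max (- noise (y, Z w) ord0 i) 0)%:E)%E.
Proof.
have [LG EG] := (G_estimator y).1 i.
have Ln : L1 P (fun w => noise (y, Z w) ord0 i).
  have := L1B LG (L1_cst P (grad f y ord0 i)).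
  by apply: eq_integrable => // w _; rewrite /= !mxE.
split=> //; have mn := L1_measurable Ln.
have max_le (a : R) : `|Num.max a 0| <= `|a|.
  by rewrite ger0_norm ?le_max ?lexx ?orbT// ge_max ler_norm normr_ge0.
have Lp : L1 P (fun w => Num.max (noise (y, Z w) ord0 i) 0).
  apply: L1_le (integrable_norm Ln); first exact: measurable_maxr.
  by move=> w; exact: max_le.
have Lm : L1 P (fun w => Num.max (- noise (y, Z w) ord0 i) 0).
  apply: L1_le (integrable_norm Ln).
    by apply: measurable_maxr => //; exact: measurable_funN.
  by move=> w; rewrite /= -[leRHS]normrN; exact: max_le.
have E0 : (\int[P]_w (noise (y, Z w) ord0 i)%:E = 0)%E.
  transitivity (\int[P]_w (G y (Z w) ord0 i - grad f y ord0 i)%:E)%E.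
    by apply: eq_integral => w _; rewrite !mxE.
  rewrite (integral_L1B LG (L1_cst _ _)); move: EG; rewrite unlock => ->.
  by rewrite integral_cst// [X in (_ - _ * X)%E]probability_setT mule1 subee.
have : (\int[P]_w (Num.max (noise (y, Z w) ord0 i) 0)%:E -
    \int[P]_w (Num.max (- noise (y, Z w) ord0 i) 0)%:E = 0)%E.
  rewrite -(integral_L1B Lp Lm) -E0; apply: eq_integral => w _.
  congr EFin; set a := noise _ _ _.
  by have [?|?] := leP a 0; have [?|?] := leP (- a) 0; lra.
have fm := integrable_fin_num measurableT Lm.
move=> H; rewrite -[LHS](@subeK _ _ (\int[P]_w
  (Num.max (- noise (y, Z w) ord0 i) 0)%:E)%E)//.
by rewrite H add0e.
Qed.

Let noise_ortho i (B : set (borelRn R n)) : measurable B ->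
  (\int[P]_(w in X @^-1` B) (noise (X w, Z w) ord0 i)%:E = 0)%E.
Proof.
move=> mB; rewrite integral_preimage.
pose part (s : R) (p : (borelRn R n * S)%type) :=
  \1_B p.1 * Num.max (s * noise p ord0 i) 0.
have m1 : measurable_fun setT (fun p : (borelRn R n * S)%type => \1_B p.1 : R).
  by apply: (@measurableT_comp _ _ _ _ _ _ (\1_B : borelRn R n -> R) _ fst).
have mpart s : measurable_fun setT (part s).
  apply: measurable_funM => //; apply: measurable_maxr => //.
  exact: measurable_funM.
have part0 s p : 0 <= part s p.
  by rewrite mulr_ge0// le_max lexx orbT.
have Ln : L1 P (fun w => noise (X w, Z w) ord0 i).
  by apply: L1_of_sqr; [exact: (Lnoise i).1|exact: (Lnoise i).2].
have Lpart s : L1 P (fun w => part s (X w, Z w)).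
  apply: L1_le (L1Z `|s| (integrable_norm Ln)).
    exact: (measurableT_comp (mpart s) mXZ).
  move=> w; rewrite ger0_norm// /part /=.
  apply: (@le_trans _ _ (1 * Num.max (s * noise (X w, Z w) ord0 i) 0)).
    by rewrite ler_wpM2r// le_max lexx orbT.
  by rewrite mul1r ge_max -normrM ler_norm normr_ge0.
transitivity (\int[P]_w (part 1 (X w, Z w) - part (-1) (X w, Z w))%:E)%E.
  apply: eq_integral => w _; rewrite -EFinM; congr EFin.
  rewrite /part -mulrBr mul1r mulN1r; congr (_ * _); set a := noise _ _ _.
  by have [?|?] := leP a 0; have [?|?] := leP (- a) 0; lra.
rewrite (integral_L1B (Lpart _) (Lpart _)).
suff -> : (\int[P]_w (part 1 (X w, Z w))%:E =
    \int[P]_w (part (-1) (X w, Z w))%:E)%E.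
  by rewrite subee//; exact: (integrable_fin_num measurableT (Lpart _)).
rewrite (freezing mX mZ XZ_indep (phi := fun p => (part 1 p)%:E)); last 2 first.
- exact/measurable_EFinP.
- by move=> p; rewrite lee_fin.
rewrite (freezing mX mZ XZ_indep (phi := fun p => (part (-1) p)%:E)); last 2 first.
- exact/measurable_EFinP.
- by move=> p; rewrite lee_fin.
apply: eq_integral => w _; have [Ly Ey] := mean_noise_part (X w) i.
have mn := L1_measurable Ly.
rewrite /part /= !integral_ge0Z//; last 4 first.
- by apply: measurable_maxr => //; exact: measurable_funM.
- by move=> w'; rewrite le_max lexx orbT.
- by apply: measurable_maxr => //; exact: measurable_funM.
- by move=> w'; rewrite le_max lexx orbT.
congr (_ * _)%E; under eq_integral do rewrite mul1r.
by rewrite Ey; under [RHS]eq_integral do rewrite mulN1r.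
Qed.

(** Freezing X turns integrals over events of the sigma-algebra of X into
    integrals of the moments of G at fixed points. The conditional variance is
    V (X), where V y is the variance of G at y. For the mean, [freezing]
    requires nonnegative integrands, so the positive and negative parts of the
    noise are compared; they have the same mean at every fixed point. *)
Lemma fresh_estimator :
  measurable_fun setT ((fun w => G (X w) (Z w)) : T -> borelRn R n) /\
  gradient_estimator_given P f v X (fun w => G (X w) (Z w)).
Proof.
split; first exact: (measurableT_comp mG mXZ).
have LGX := L2vec_grad L_gt0 f_smooth LX.
have sigmaX (h : borelRn R n -> R) : measurable_fun setT h ->
    forall B : set R, measurable B ->
    g_sigma_algebra_preimage (X : T -> borelRn R n) ((fun w => h (X w)) @^-1` B).
  move=> mh B mB; exists (h @^-1` B); last by rewrite setTI.
  by rewrite -[X in measurable X]setTI; exact: mh.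
split=> [i|].
  have Lgrad : L1 P (fun w => grad f (X w) ord0 i).
    by apply: L1_of_sqr; [exact: (LGX i).1|exact: (LGX i).2].
  have Ln : L1 P (fun w => noise (X w, Z w) ord0 i).
    by apply: L1_of_sqr; [exact: (Lnoise i).1|exact: (Lnoise i).2].
  have GE : (fun w => G (X w) (Z w) ord0 i) =
      (fun w => noise (X w, Z w) ord0 i + grad f (X w) ord0 i).
    by apply/funext => w; rewrite /noise !mxE subrK.
  split.
  - by rewrite GE; exact: L1D.
  - exact: Lgrad.
  - exact: sigmaX (mgrad i).
  move=> _ [B mB <-]; rewrite setTI.
  have mXB : measurable (X @^-1` B).
    by rewrite -[X in measurable X]setTI; exact: mX.
  have iS (h : T -> R) : L1 P h -> P.-integrable (X @^-1` B) (EFin \o h).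
    by move=> Lh; apply: integrableS Lh.
  rewrite (eq_integral (fun w => (noise (X w, Z w) ord0 i)%:E +
      (grad f (X w) ord0 i)%:E)%E); last first.
    by move=> w _; rewrite -EFinD; congr EFin; exact: (congr1 (@^~ w) GE).
  rewrite integralD//; [|exact: iS|exact: iS].
  by rewrite noise_ortho// add0e.
have mfV : measurable_fun setT ((fun y => fine (V y)) : borelRn R n -> R).
  exact: measurableT_comp.
exists (fun w => fine (V (X w))); split; last first.
  by apply: aeW => w; rewrite -lee_fin fineK.
split.
- exact: L1sq.
- apply: L1_le (L1_cst P v); first exact: (measurableT_comp mfV mX).
  by move=> w; rewrite ger0_norm ?fine_ge0// -lee_fin fineK.
- exact: sigmaX mfV.
move=> _ [B mB <-]; rewrite setTI.
rewrite [LHS](integral_sq mB); apply: eq_integral => w _.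
by rewrite fineK.
Qed.

End fresh_estimator.

(** * Seeds organised in stages *)

Section staged_seeds.
Context (R : realType) (n : nat) d (T : measurableType d) (P : probability T R).
Context (f : 'rV[R]_n -> R) (L v : R) (x0 : 'rV[R]_n).
Hypotheses (L_gt0 : 0 < L) (f_smooth : L_smooth L f).
Context (I : eqType) dS (S : measurableType dS) (xi : I -> T -> S) (stage : I -> nat).
Hypothesis mxi : forall i, measurable_fun setT (xi i).
Hypothesis xi_indep : mutually_independent P xi.

Definition past k := preimages xi [set i | (stage i < k)%N].
Definition present k := preimages xi [set i | stage i = k].

Lemma id_measurable (A B : set (set T)) : A `<=` <<s B >> ->
  measurable_fun setT (idfun : g_sigma_algebraType B -> g_sigma_algebraType A).
Proof.
move=> AB _ C mC; rewrite setTI.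
suff : <<s A >> `<=` <<s B >> by exact.
by apply: smallest_sub => //; exact: smallest_sigma_algebra.
Qed.

Lemma preimagesS (A B : set I) : A `<=` B -> preimages xi A `<=` <<s preimages xi B >>.
Proof.
move=> AB C [i Ai iC]; apply: sub_sigma_algebra.
by exists i => //; exact: AB.
Qed.

Lemma seed_measurable (A : set I) i : A i ->
  measurable_fun setT (xi i : g_sigma_algebraType (preimages xi A) -> S).
Proof.
move=> Ai _ B mB; apply: sub_sigma_algebra; exists i => //.
by exists B.
Qed.

Context (G : nat -> 'rV[R]_n -> T -> 'rV[R]_n).
Hypothesis mG : forall k, measurable_fun setT ((fun p => G k p.1 p.2) :
  (borelRn R n * g_sigma_algebraType (present k))%type -> borelRn R n).
Hypothesis G_estimator : forall k, gradient_estimator P f v (G k).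

Let x k w := sgd L x0 (fun j y => G j y w) k.

(** By induction: x_(k+1) is built from x_k and from the seeds of stage k,
    both measurable for the seeds of stages at most k. *)
Lemma iterate_past_measurable k :
  measurable_fun setT (x k : g_sigma_algebraType (past k) -> borelRn R n).
Proof.
elim: k => [|k IH]; first exact: measurable_cst.
have mxk : measurable_fun setT
    (x k : g_sigma_algebraType (past k.+1) -> borelRn R n).
  have sub : past k `<=` <<s past k.+1 >>.
    by apply: preimagesS => i /= ik; exact: ltnW.
  exact: (measurableT_comp IH (id_measurable sub)).
have mid : measurable_fun setT
    (idfun : g_sigma_algebraType (past k.+1) -> g_sigma_algebraType (present k)).
  by apply: id_measurable; apply: preimagesS => i /= ->.
have mGk := measurableT_comp (@mG k) (measurable_fun_pair mxk mid).
apply: measurable_borelRn => i.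
have -> : (fun w => x k.+1 w ord0 i) = (fun w => x k w ord0 i +
    (- (1 / (2 * L))) * G k (x k w) w ord0 i).
  by apply/funext => w; rewrite /x /= !mxE mulNr.
apply: measurable_funD; first exact: measurable_coord mxk.
by apply: measurable_funM => //; exact: measurable_coord mGk.
Qed.

Lemma iterate_seed_family k (B : set (borelRn R n)) : measurable B ->
  sigma_family xi (x k @^-1` B).
Proof.
move=> mB; rewrite -[_ @^-1` _]setTI.
have past_sub : <<s past k >> `<=` <<s preimages xi setT >>.
  by apply: smallest_sub; [exact: smallest_sigma_algebra|exact: preimagesS].
apply: past_sub; exact: (@iterate_past_measurable k measurableT B mB).
Qed.

(** The seeds of stage k are fed to [fresh_estimator] as the identity map into
    T with the sigma-algebra they generate, so that one stage may use any
    number of seeds. Square-integrability of x_k, needed for step k, is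
    established along the way. *)
Lemma staged_sgd_process :
  sgd_process P f L v x0 x (fun k w => G k (x k w) w).
Proof.
have sub A : <<s preimages xi A >> `<=` measurable.
  apply: smallest_sub; first exact: sigma_algebra_measurable.
  exact: preimages_measurable.
have mid k : measurable_fun setT (idfun : T -> g_sigma_algebraType (present k)).
  by move=> _ B mB; rewrite setTI; exact: sub mB.
have fresh k : L2vec P (x k) ->
    measurable_fun setT ((fun w => G k (x k w) w) : T -> borelRn R n) /\
    gradient_estimator_given P f v (x k) (fun w => G k (x k w) w).
  move=> Lx.
  apply: (fresh_estimator L_gt0 f_smooth Lx (mid k) (@mG k) _ (@G_estimator k)).
  move=> A B mA mB; apply: (grouping mxi xi_indep (A := [set i | (stage i < k)%N])
    (B := [set i | stage i = k])).
  - by apply/seteqP; split=> [i /= [+ ik]|//]; rewrite ik ltnn.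
  - by rewrite -[_ @^-1` _]setTI; exact: iterate_past_measurable.
  - exact: mB.
have Lx k : L2vec P (x k).
  elim: k => [|k IH]; first exact: L2vec_cst.
  have [mg gg] := fresh k IH.
  apply: L2vecB => //; apply: L2vecZ.
  exact: estimator_L2vec L_gt0 f_smooth IH mg gg.
by split=> // k; have [] := fresh k (Lx k).
Qed.

End staged_seeds.

Section law.
Context (R : realType) (n : nat) d dS (T : measurableType d)
  (S : measurableType dS) (P : probability T R) (mu : probability S R).
Context (Z : T -> S).
Hypothesis mZ : measurable_fun setT Z.
Hypothesis law_Z : forall A, measurable A -> P (Z @^-1` A) = mu A.

Let Zf : {mfun T >-> S} := HB.pack Z (isMeasurableFun.Build _ _ _ _ _ mZ).

Lemma law_ge0_integral (h : S -> \bar R) : measurable_fun setT h ->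
  (forall z, (0 <= h z)%E) -> (\int[P]_w h (Z w) = \int[mu]_z h z)%E.
Proof.
move=> mh h0; transitivity (\int[distribution P Zf]_z h z)%E.
  by rewrite ge0_integral_distribution.
by apply: eq_measure_integral => A mA _; exact: law_Z.
Qed.

Lemma law_L1 (h : S -> R) : L1 mu h -> L1 P (fun w => h (Z w)).
Proof.
move=> Lh; have mh := L1_measurable Lh; apply/integrableP; split.
  by apply/measurable_EFinP; exact: measurableT_comp.
rewrite (law_ge0_integral (h := fun z => `|(h z)%:E|%E)).
- by have /integrableP[] := Lh.
- by apply: measurableT_comp => //; exact/measurable_EFinP.
- by move=> z; exact: abse_ge0.
Qed.

Lemma law_integral (h : S -> R) : L1 mu h ->
  (\int[P]_w (h (Z w))%:E = \int[mu]_z (h z)%:E)%E.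
Proof.
move=> Lh; have mh : measurable_fun setT (EFin \o h).
  by apply/measurable_EFinP; exact: L1_measurable Lh.
transitivity (\int[distribution P Zf]_z (h z)%:E)%E.
  by rewrite integral_distribution//; exact: law_L1 Lh.
by apply: eq_measure_integral => A mA _; exact: law_Z.
Qed.

Lemma law_gradient_estimator (f : 'rV[R]_n -> R) v (G : 'rV[R]_n -> S -> 'rV[R]_n) :
  gradient_estimator mu f v G ->
  gradient_estimator P f v (fun y w => G y (Z w)).
Proof.
move=> est y; have [Gm Gv] := est y; split=> [i|].
  have [LG EG] := Gm i; split; first exact: (law_L1 LG).
  by move: EG; rewrite !unlock (law_integral LG).
move: Gv; rewrite !unlock.
rewrite (law_ge0_integral (h := fun z => (enorm (G y z - grad f y) ^+ 2)%:E))//.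
- apply/measurable_EFinP; apply: measurable_enorm_sqr.
  apply: measurable_borelRn => i; under eq_fun do rewrite !mxE.
  by apply: measurable_funB => //; exact: L1_measurable (Gm i).1.
- by move=> z; rewrite lee_fin sqr_ge0.
Qed.

End law.

(** * Variance of averages *)

Section minibatch_variance.
Context (R : realType) (n : nat) d (T : measurableType d) (P : probability T R).

(** Orthogonality is used twice: the centred indicator of an event of Z1 is
    orthogonal to h2 (Z2), hence h2 (Z2) has integral 0 over that event, hence
    it is orthogonal to h1 (Z1). *)
Lemma indep_mean_zero d1 d2 (S1 : measurableType d1) (S2 : measurableType d2)
    (Z1 : T -> S1) (Z2 : T -> S2) (h1 : S1 -> R) (h2 : S2 -> R) :
  measurable_fun setT Z1 -> measurable_fun setT Z2 ->
  (forall A B, measurable A -> measurable B ->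
    P (Z1 @^-1` A `&` Z2 @^-1` B) = (P (Z1 @^-1` A) * P (Z2 @^-1` B))%E) ->
  measurable_fun setT h1 -> measurable_fun setT h2 ->
  L1 P (fun w => h2 (Z2 w)) -> (\int[P]_w (h2 (Z2 w))%:E = 0)%E ->
  L1 P (fun w => h1 (Z1 w) * h2 (Z2 w)) ->
  (\int[P]_w (h1 (Z1 w) * h2 (Z2 w))%:E = 0)%E.
Proof.
move=> mZ1 mZ2 ind mh1 mh2 L2 m2 L12.
apply: (integral_comp_ortho mZ1 L2 _ mh1 L12) => A mA.
have mZA : measurable (Z1 @^-1` A).
  by rewrite -[X in measurable X]setTI; exact: mZ1.
pose e w : R := \1_(Z1 @^-1` A) w - fine (P (Z1 @^-1` A)).
have Le : L1 P e by apply: L1B; [exact: integrable_indic|exact: L1_cst].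
have L2i : L1 P (fun w => h2 (Z2 w) * \1_(Z1 @^-1` A) w).
  apply: L1_le (integrable_norm L2).
    by apply: measurable_funM; [exact: measurableT_comp|exact: measurable_indic].
  by move=> w; rewrite /= normrM [`|\1_(_) w|]ger0_norm// ler_piMr.
have L2c := L1Z (fine (P (Z1 @^-1` A))) L2.
have eE w : h2 (Z2 w) * e w =
    h2 (Z2 w) * \1_(Z1 @^-1` A) w - fine (P (Z1 @^-1` A)) * h2 (Z2 w).
  by rewrite /e mulrBr [X in _ - X]mulrC.
have : (\int[P]_w (h2 (Z2 w) * e w)%:E = 0)%E.
  apply: (integral_comp_ortho mZ2 Le _ mh2) => [B mB|]; last first.
    by apply: eq_integrable (L1B L2i L2c) => // w _; rewrite /= eE.
  have mZB : measurable (Z2 @^-1` B).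
    by rewrite -[X in measurable X]setTI; exact: mZ2.
  transitivity (\int[P]_(w in Z2 @^-1` B) (\1_(Z1 @^-1` A) w)%:E -
      \int[P]_(w in Z2 @^-1` B) (fine (P (Z1 @^-1` A)))%:E)%E.
    rewrite -integralB//.
      by apply: integrableS (integrable_indic P mZA) => //.
    by apply: integrableS (L1_cst P (fine (P (Z1 @^-1` A)))) => //.
  rewrite integral_indic// integral_cst// fineK ?fin_num_measure//.
  by rewrite [X in (X - _)%E]ind// subee// fin_numM// fin_num_measure.
under eq_integral do rewrite eE.
rewrite (integral_L1B L2i L2c) (integral_L1Z _ L2) m2 mule0 sube0 => <-.
rewrite integral_mkcond; apply: eq_integral => w _.
by rewrite /patch indicE; case: ifP => _; rewrite ?mulr1 ?mulr0.
Qed.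

Context (r : nat) (Y : 'I_r -> T -> 'rV[R]_n) (m : 'rV[R]_n) (s2 : R).
Hypothesis r_gt0 : (0 < r)%N.
Hypothesis Y_mean : forall i, has_mean P (Y i) m.
Hypothesis Y_var : forall i, ('E_P[fun w => (enorm (Y i w - m) ^+ 2)%R] <= s2%:E)%E.

Let D i w := Y i w - m.

Let mD i : measurable_fun setT (D i : T -> borelRn R n).
Proof.
apply: measurable_borelRn => c; under eq_fun do rewrite !mxE.
by apply: measurable_funB => //; exact: L1_measurable (Y_mean i c).1.
Qed.

Let D_var i : (\int[P]_w (enorm (D i w) ^+ 2)%:E <= s2%:E)%E.
Proof. by have := Y_var i; rewrite unlock. Qed.

Lemma deviation_L2vec i : L2vec P (fun w => Y i w - m).
Proof.
apply: L2vec_enorm; first exact: mD.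
apply: (ge0_L1 _ _ (D_var i)); last by move=> w; exact: sqr_ge0.
exact: measurable_enorm_sqr (mD i).
Qed.

Hypothesis Y_uncorrelated : forall i j c, i != j ->
  (\int[P]_w ((Y i w - m) ord0 c * (Y j w - m) ord0 c)%:E = 0)%E.

Let mean w := (1 / r%:R) *: \sum_(i < r) Y i w.

Lemma average_mean : has_mean P mean m.
Proof.
have r0 : r%:R != 0 :> R by rewrite pnatr_eq0 -lt0n.
have E c w : mean w ord0 c = 1 / r%:R * \sum_(i < r) Y i w ord0 c.
  by rewrite /mean mxE summxE.
move=> c; have LY i : L1 P (fun w => Y i w ord0 c) := (Y_mean i c).1.
have LS : L1 P (fun w => \sum_(i < r) Y i w ord0 c) by exact: L1_sum.
split; first by under eq_fun do rewrite E; exact: L1Z LS.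
rewrite unlock; under eq_integral do rewrite E.
rewrite (integral_L1Z _ LS) integral_L1_sum//.
rewrite (eq_bigr (fun=> (m ord0 c)%:E)); last first.
  by move=> i _; have := (Y_mean i c).2; rewrite unlock.
rewrite sumEFin sumr_const card_ord -EFinM -[m ord0 c *+ r]mulr_natl; congr EFin.
by rewrite mul1r mulrA mulVf// mul1r.
Qed.

(** The squared norm of a sum expands into all pairwise inner products, of
    which only the r diagonal ones have a nonzero mean. *)
Lemma average_variance :
  ('E_P[fun w => (enorm (mean w - m) ^+ 2)%R] <= (s2 / r%:R)%:E)%E.
Proof.
have r0 : 0 < r%:R :> R by rewrite ltr0n.
have E w : enorm (mean w - m) ^+ 2 =
    (1 / r%:R) ^+ 2 * \sum_(i < r) \sum_(j < r) dot (D i w) (D j w).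
  have -> : mean w - m = (1 / r%:R) *: \sum_(i < r) D i w.
    rewrite sumrB scalerBr sumr_const card_ord -[m *+ r]scaler_nat scalerA.
    by rewrite mul1r mulVf ?gt_eqF// scale1r /mean mul1r.
  rewrite enorm_sqr dotZl dotZr mulrA -expr2; congr (_ * _).
  rewrite /dot.
  under [RHS]eq_bigr do rewrite exchange_big /=.
  rewrite [RHS]exchange_big /=; apply: eq_bigr => c _.
  by rewrite summxE big_distrlr.
have LD i j : L1 P (fun w => dot (D i w) (D j w)).
  by apply: L1_dot; exact: deviation_L2vec.
have LD1 i : L1 P (fun w => \sum_(j < r) dot (D i w) (D j w)) by exact: L1_sum.
rewrite unlock; under eq_integral do rewrite E.
rewrite integral_L1Z ?integral_L1_sum//; last exact: L1_sum.
have diag i : (\int[P]_w (\sum_(j < r) dot (D i w) (D j w))%:E <= s2%:E)%E.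
  rewrite integral_L1_sum// (bigD1 i)//= big1 ?adde0.
    by under eq_integral do rewrite -enorm_sqr; exact: D_var.
  move=> j ji; rewrite integral_L1_sum; last first.
    move=> c; apply: L1M.
    - exact: (deviation_L2vec i c).1.
    - exact: (deviation_L2vec j c).1.
    - exact: (deviation_L2vec i c).2.
    - exact: (deviation_L2vec j c).2.
  by apply: big1 => c _; apply: Y_uncorrelated; rewrite eq_sym.
apply: (@le_trans _ _ (((1 / r%:R) ^+ 2)%:E * \sum_(i < r) s2%:E)%E).
  rewrite lee_wpmul2l ?lee_fin ?sqr_ge0//.
  by apply: lee_sum => i _; exact: diag.
rewrite sumEFin sumr_const card_ord -EFinM lee_fin -[s2 *+ r]mulr_natl.
rewrite le_eqVlt; apply/orP; left; apply/eqP.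
by move: r0; move: (r%:R : R) => q q0; field; rewrite gt_eqF.
Qed.

End minibatch_variance.

(** * Counting gradient evaluations and conclusion *)

Section counting.
Context (R : realType) (n : nat) (Xi : Type) (F : 'rV[R]_n -> Xi -> R).

Lemma counted_sumE (x : 'rV[R]_n) (s : seq Xi) :
  counted_sum F x s = (\sum_(z <- s) grad (F ^~ z) x, size s).
Proof.
elim: s => [|z s IH]; first by rewrite big_nil.
by rewrite /counted_sum /= -/(counted_sum F x s) IH big_cons.
Qed.

Lemma counted_minibatch_sgdE (L : R) (x0 : 'rV[R]_n) r (z : nat -> 'I_r -> Xi) k :
  counted_minibatch_sgd F L x0 z k =
  (sgd L x0 (fun j => minibatch F (z j)) k, (k * r)%N).
Proof.
elim: k => [//|k IH] /=; rewrite IH counted_sumE size_map size_enum_ord.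
by rewrite mulSn addnC /minibatch big_map big_enum.
Qed.

End counting.

Section epsilon_bound.
Context (R : realType) (n : nat) d (T : measurableType d) (P : probability T R).
Context (f : 'rV[R]_n -> R) (L fstar eps : R) (x0 : 'rV[R]_n).
Hypotheses (L_gt0 : 0 < L) (f_smooth : L_smooth L f).
Hypotheses (f_lb : forall y, fstar <= f y) (eps_gt0 : 0 < eps).

(** [sgd_mean_sq_grad] with v = eps^2 / 2 gives the constants 8/3 and 1/6,
    smaller than the stated 4 and 1/2. *)
Lemma sgd_epsilon_bound (x g : nat -> T -> 'rV[R]_n) (F : set (set T)) :
  sgd_process P f L (eps ^+ 2 / 2) x0 x g ->
  (forall k (B : set (borelRn R n)), measurable B -> F (x k @^-1` B)) ->
  forall (N : nat) (J : T -> nat), (0 < N)%N -> uniform_index P N J F ->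
    (mean_sq_grad P f x J <=
       (4 * L * (f x0 - fstar) / N%:R + eps ^+ 2 / 2)%:E)%E /\
    (N%:R = 8 * L * (f x0 - fstar) / eps ^+ 2 ->
       (mean_sq_grad P f x J <= (eps ^+ 2)%:E)%E).
Proof.
move=> sgdx Fx N J N0 JU.
have bound := sgd_mean_sq_grad L_gt0 f_smooth f_lb sgdx N0 JU Fx.
have N0' : 0 < N%:R :> R by rewrite ltr0n.
have a0 : 0 <= L * (f x0 - fstar) / N%:R.
  by rewrite divr_ge0 ?mulr_ge0 ?subr_ge0// ltW.
have e0 : 0 < eps ^+ 2 by rewrite exprn_gt0.
have bound2 : (mean_sq_grad P f x J <=
    (4 * L * (f x0 - fstar) / N%:R + eps ^+ 2 / 2)%:E)%E.
  apply: (le_trans bound); rewrite lee_fin.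
  have -> : 8 * L / 3 * (f x0 - fstar) / N%:R =
      8 / 3 * (L * (f x0 - fstar) / N%:R) by lra.
  have -> : 4 * L * (f x0 - fstar) / N%:R =
      4 * (L * (f x0 - fstar) / N%:R) by lra.
  by lra.
split=> // NE; apply: (le_trans bound2); rewrite lee_fin.
have : N%:R * eps ^+ 2 = 8 * L * (f x0 - fstar) by rewrite NE divfK ?gt_eqF.
move=> H; have -> : 4 * L * (f x0 - fstar) / N%:R = eps ^+ 2 / 2.
  apply: (mulIf (lt0r_neq0 N0')); rewrite divfK ?gt_eqF//.
  by lra.
by lra.
Qed.

End epsilon_bound.
Theorem mainTheorem1 (R : realType) (n : nat) (f : 'rV[R]_n -> R)
    (L fstar eps : R) (x0 : 'rV[R]_n)
    (L_gt0 : 0 < L) (f_smooth : L_smooth L f) (f_lb : forall x, fstar <= f x)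
    (eps_gt0 : 0 < eps)
    (d : measure_display) (T : measurableType d) (P : probability T R) :
  (* (1), conditional form: the two estimator conditions hold conditionally on
     the current iterate *)
  (forall x g : nat -> T -> 'rV[R]_n,
     sgd_process P f L (eps ^+ 2 / 2) x0 x g ->
     forall (N : nat) (J : T -> nat), (0 < N)%N ->
       uniform_index P N J
         (sigma_family (x : nat -> T -> borelRn R n)) ->
       (mean_sq_grad P f x J <=
          (4 * L * (f x0 - fstar) / N%:R + eps ^+ 2 / 2)%:E)%E /\
       (N%:R = 8 * L * (f x0 - fstar) / eps ^+ 2 ->
          (mean_sq_grad P f x J <= (eps ^+ 2)%:E)%E)) /\
  (* (1), fresh randomness form: an estimator G(x, zeta) that satisfies the two
     conditions at every point x is run with i.i.d. seeds zeta_0, zeta_1, ... *)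
  (forall (dS : measure_display) (S : measurableType dS) (mu : probability S R)
     (G : 'rV[R]_n -> S -> 'rV[R]_n) (zeta : nat -> T -> S),
     measurable_fun setT
       ((fun p => G p.1 p.2) : (borelRn R n * S)%type -> borelRn R n) ->
     gradient_estimator mu f (eps ^+ 2 / 2) G ->
     iid P mu zeta ->
     let x := fun k w => sgd L x0 (fun j y => G y (zeta j w)) k in
     sgd_process P f L (eps ^+ 2 / 2) x0 x (fun k w => G (x k w) (zeta k w)) /\
     forall (N : nat) (J : T -> nat), (0 < N)%N ->
       uniform_index P N J (sigma_family zeta) ->
       (mean_sq_grad P f x J <=
          (4 * L * (f x0 - fstar) / N%:R + eps ^+ 2 / 2)%:E)%E /\
       (N%:R = 8 * L * (f x0 - fstar) / eps ^+ 2 ->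
          (mean_sq_grad P f x J <= (eps ^+ 2)%:E)%E)) /\
  (* (2) *)
  (forall (dX : measure_display) (Xi : measurableType dX)
     (D : probability Xi R) (F : 'rV[R]_n -> Xi -> R) (sigma : R),
     (forall z x, differentiable (F ^~ z) x) ->
     (forall x, D.-integrable setT (EFin \o F x) /\
                ('E_D[F x] = (f x)%:E)%E) ->
     gradient_estimator D f (sigma ^+ 2) (fun x z => grad (F ^~ z) x) ->
     forall (r : nat) (xi : nat * 'I_r -> T -> Xi),
     (0 < r)%N -> r%:R = Num.max 1 (2 * sigma ^+ 2 / eps ^+ 2) ->
     iid P D xi ->
     let g := fun k x w => minibatch F (fun i : 'I_r => xi (k, i) w) x in
     let x := fun k w => sgd L x0 (fun j y => g j y w) k in
     (forall k, gradient_estimator P f (eps ^+ 2 / 2) (g k)) /\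
     sgd_process P f L (eps ^+ 2 / 2) x0 x (fun k w => g k (x k w) w) /\
     forall (N : nat) (J : T -> nat), (0 < N)%N ->
       N%:R = 8 * L * (f x0 - fstar) / eps ^+ 2 ->
       uniform_index P N J (sigma_family xi) ->
       (mean_sq_grad P f x J <= (eps ^+ 2)%:E)%E /\
       forall w : T,
         let run := counted_minibatch_sgd F L x0 (fun k i => xi (k, i) w) in
         (forall k, (run k).1 = x k w) /\
         (run N).2%:R =
           Num.max (8 * L * (f x0 - fstar) / eps ^+ 2)
             (16 * L * (f x0 - fstar) * sigma ^+ 2 / eps ^+ 4)).
Proof.
split; [|split].
- move=> x g sgdx N J N0 JU.
  apply: (sgd_epsilon_bound L_gt0 f_smooth f_lb eps_gt0 sgdx) JU => //.
  move=> k B mB; apply: sub_sigma_algebra; exists k => //.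
  by exists B => //; rewrite setTI.
- move=> dS S mu G zeta mG est [mzeta law_zeta ind] x.
  have mGk k : measurable_fun setT ((fun p => G p.1 (zeta k p.2)) :
      (borelRn R n * g_sigma_algebraType (present zeta id k))%type -> borelRn R n).
    have mz : measurable_fun setT
        (zeta k : g_sigma_algebraType (present zeta id k) -> S).
      exact: seed_measurable.
    exact: (measurableT_comp mG (measurable_fun_pair
      (@measurable_fst _ _ (borelRn R n) _) (measurableT_comp mz measurable_snd))).
  have estk k : gradient_estimator P f (eps ^+ 2 / 2) (fun y w => G y (zeta k w)).
    exact: (law_gradient_estimator (mzeta k) (law_zeta k) est).
  have proc := staged_sgd_process x0 L_gt0 f_smooth mzeta ind mGk estk.
  split; first exact: proc.
  move=> N J N0 JU.
  apply: (sgd_epsilon_bound L_gt0 f_smooth f_lb eps_gt0 proc) JU => //.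
  by move=> k B mB; exact (iterate_seed_family L x0
    (G := fun k y w => G y (zeta k w)) mGk k mB).
- move=> dX Xi D F sigma dF F_mean est r xi r0 rE [mxi law_xi ind] g x.
  have e0 : 0 < eps ^+ 2 by rewrite exprn_gt0.
  have r0' : 0 < r%:R :> R by rewrite ltr0n.
  have mF y : measurable_fun setT (F y) := L1_measurable (F_mean y).1.
  have law_est k i : gradient_estimator P f (sigma ^+ 2)
      (fun y w => grad (F ^~ (xi (k, i) w)) y).
    exact: (law_gradient_estimator (mxi (k, i)) (law_xi (k, i)) est).
  have mgrad y c : measurable_fun setT (fun z => grad (F ^~ z) y ord0 c).
    exact: L1_measurable ((est y).1 c).1.
  have pair_indep a b : a != b -> forall A B, measurable A -> measurable B ->
      P (xi a @^-1` A `&` xi b @^-1` B) =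
      (P (xi a @^-1` A) * P (xi b @^-1` B))%E.
    move=> ab A B mA mB.
    have uab : uniq [:: a; b] by rewrite /= inE ab.
    have := ind _ (fun i => if i == a then A else B) uab.
    rewrite big_cons big_seq1 eqxx eq_sym (negbTE ab) => <-; last first.
      by move=> i; case: ifP.
    congr (P _); apply/seteqP; split=> [w [wA wB] i|w H].
      by rewrite /= !inE => /orP[] /eqP ->; rewrite ?eqxx// eq_sym (negbTE ab).
    split; first by have := H a; rewrite /= inE eqxx => /(_ isT).
    by have := H b; rewrite /= !inE eqxx orbT eq_sym (negbTE ab) => /(_ isT).
  have estk k : gradient_estimator P f (eps ^+ 2 / 2) (g k).
    move=> y; pose Y i w := grad (F ^~ (xi (k, i) w)) y.
    have Ymean i : has_mean P (Y i) (grad f y) := (law_est k i y).1.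
    have Yvar i := (law_est k i y).2.
    have Yunc i j c : i != j -> (\int[P]_w ((Y i w - grad f y) ord0 c *
        (Y j w - grad f y) ord0 c)%:E = 0)%E.
      move=> ij; have dev := deviation_L2vec Ymean Yvar.
      pose h z := (grad (F ^~ z) y - grad f y) ord0 c.
      have mh : measurable_fun setT h.
        rewrite /h; under eq_fun do rewrite mxE.
        exact: measurable_funD.
      have Lj : L1 P (fun w => (Y j w - grad f y) ord0 c).
        by apply: L1_of_sqr; [exact: (dev j c).1|exact: (dev j c).2].
      apply: (indep_mean_zero (h1 := h) (h2 := h) (mxi (k, i)) (mxi (k, j))) => //.
      - by apply: pair_indep; rewrite xpair_eqE eqxx.
      - have [LY EY] := Ymean j c; move: EY; rewrite unlock => EY.
        transitivity (\int[P]_w (Y j w ord0 c - grad f y ord0 c)%:E)%E.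
          by apply: eq_integral => w _; rewrite /h !mxE.
        rewrite (integral_L1B LY (L1_cst P _)) EY.
        by rewrite integral_cst// [X in (_ - _ * X)%E]probability_setT mule1 subee.
      - apply: L1M.
        + exact: (dev i c).1.
        + exact: (dev j c).1.
        + exact: (dev i c).2.
        + exact: (dev j c).2.
    split; first exact: (average_mean r0 Ymean).
    apply: (le_trans (average_variance r0 Ymean Yvar Yunc)).
    rewrite lee_fin ler_pdivrMr//.
    have : 2 * sigma ^+ 2 / eps ^+ 2 <= r%:R by rewrite rE le_max lexx orbT.
    by rewrite ler_pdivrMr//; lra.
  have mgk k : measurable_fun setT ((fun p => g k p.1 p.2) :
      (borelRn R n * g_sigma_algebraType (present xi fst k))%type -> borelRn R n).
    apply: measurable_borelRn => c.
    under eq_fun do rewrite mxE summxE.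
    apply: measurable_funM => //; apply: measurable_sum => i.
    have mz : measurable_fun setT
        (xi (k, i) : g_sigma_algebraType (present xi fst k) -> Xi).
      exact: seed_measurable.
    exact: (measurableT_comp (grad_measurable mF c dF) (measurable_fun_pair
      (@measurable_fst _ _ (borelRn R n) _) (measurableT_comp mz measurable_snd))).
  have proc := staged_sgd_process x0 L_gt0 f_smooth mxi ind mgk estk.
  split=> //; split; first exact: proc.
  move=> N J N0 NE JU; split.
    apply: (sgd_epsilon_bound L_gt0 f_smooth f_lb eps_gt0 proc _ N0 JU).2 => //.
    by move=> k B mB; exact (iterate_seed_family L x0 (G := g) mgk k mB).
  move=> w run; split=> [k|]; rewrite /run counted_minibatch_sgdE//.
  rewrite /= natrM NE rE maxr_pMr; last by rewrite -NE ler0n.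
  rewrite mulr1; congr Num.max.
  by field; rewrite gt_eqF.
Qed.
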